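(* There are absolute constants $C,c>0$ such that the following holds. Let $\alpha>0$ and $0\le\varepsilon\le0.1$ satisfy $\varepsilon^\alpha\le\min\{0.0106,\ \frac{1.8}{\ln(10/\varepsilon^{1+\alpha})}\}$, and let $G=(V,E)$, $V=[n]$, be any graph with $m\ge C/\varepsilon^2$ edges. Then the output $S$ of the following algorithm satisfies $\mathbb E[\mathrm{val}_G(S)]\ge(\frac12+c\,\varepsilon^{1+\alpha})\mathrm{OPT}_G$. Algorithm: (1) set $d=24/\varepsilon^{1+\alpha}$; for each $v$ let $\hat d(v)=d(v)+\mathrm{Lap}(12/\varepsilon)$ (independent) and $V_1=\{v:\hat d(v)>d\}$. (2) Let $G_1=(V_1,E_1)$ with $E_1$ the edges with both endpoints in $V_1$; sample $S_1^A\in\{\pm1\}^{V_1}$ with $\Pr[S_1^A=\hat S]\propto\exp(\varepsilon\,\mathrm{val}_{G_1}(\hat S)/12)$. (3) Let $V_2=V\setminus V_1$ and $\widetilde E$ the edges with both endpoints in $V_2$; form $E_2$ by keeping each edge of $\widetilde E$ independently with probability $\varepsilon^{1+\alpha}/70$; let $G_2=(V_2,E_2)$; each $v\in V_2$ picks a uniformly random neighbor $f(v)$ in $G_2$ ($f(v)=\bot$ if isolated); let $E_M=\{\{u,v\}\in E_2: f(u)=v,f(v)=u\}$ and $G_M=(V_2,E_M)$. (4) Sample $S_2^A\in\{\pm1\}^{V_2}$ with $\Pr[S_2^A=\hat S]\propto\exp(2.5\,\mathrm{val}_{G_M}(\hat S)/4)$. (5) Let $S_1^B$ be uniform in $\{\pm1\}^{V_2}$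 and $S_2^B$ uniform in $\{\pm1\}^{V_1}$; $S_1$ is the concatenation of $S_1^A,S_1^B$, $S_2$ the concatenation of $S_2^A,S_2^B$, and $S_3$ is the cut $(V_1,V_2)$. (6) Output one of $S_1,S_2,S_3$ chosen by the exponential mechanism with privacy budget $\varepsilon/2$ and score $\mathrm{val}_G$ (sensitivity $1$), i.e. $S_i$ is chosen with probability proportional to $\exp(\varepsilon\,\mathrm{val}_G(S_i)/4)$.
   Context: $G$ is a simple undirected graph with degrees $d(v)$. A cut is an assignment in $\{\pm1\}^V$ (the cut $(V_1,V_2)$ assigns $+1$ to $V_1$ and $-1$ to $V_2$); $\mathrm{val}_H(S)$ is the number of edges of $H$ whose endpoints receive different values, and $\mathrm{OPT}_G$ is the maximum cut size of $G$. $\mathrm{Lap}(b)$ has density $\frac1{2b}e^{-|x|/b}$. *)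

(* Defs.v *)
From HB Require Import structures.
From mathcomp Require Import all_boot all_order all_algebra.
From mathcomp Require Import all_classical all_reals all_analysis.
Set Implicit Arguments. Unset Strict Implicit. Unset Printing Implicit Defensive.
Import Order.TTheory GRing.Theory Num.Theory.
Import numFieldNormedType.Exports.
Local Open Scope ring_scope.

(* A simple graph on V = [n] = 'I_n is a symmetric irreflexive relation e.
   An (unordered) edge {u,v} is represented by the pair (u,v) with u < v.
   A cut is an assignment V -> bool (true = +1, false = -1). *)
Definition edge_set n (e : rel 'I_n) : {set 'I_n * 'I_n} :=
  [set p : 'I_n * 'I_n | (p.1 < p.2)%N && e p.1 p.2].

Definition deg n (e : rel 'I_n) (v : 'I_n) : nat := #|[set u | e v u]|.

Definition val n (H : {set 'I_n * 'I_n}) (S : {ffun 'I_n -> bool}) : nat :=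
  #|[set p in H | S p.1 != S p.2]|.

Definition OPT n (e : rel 'I_n) : nat :=
  \max_(S : {ffun 'I_n -> bool}) val (edge_set e) S.

Definition induced n (H : {set 'I_n * 'I_n}) (A : {set 'I_n}) :=
  [set p in H | (p.1 \in A) && (p.2 \in A)].

(* An assignment in {+-1}^A is encoded as a cut which is false (-1) off A;
   restr A S is the restriction of S to A in this encoding. *)
Definition restr n (A : {set 'I_n}) (S : {ffun 'I_n -> bool}) : {ffun 'I_n -> bool} :=
  [ffun v => (v \in A) && S v].

Definition expmech {R : realType} n (A : {set 'I_n}) (beta : R)
    (H : {set 'I_n * 'I_n}) (T : {ffun 'I_n -> bool}) : R :=
  if restr A T == T then
    expR (beta * (val H T)%:R) /
      \sum_(T' : {ffun 'I_n -> bool} | restr A T' == T') expR (beta * (val H T')%:R)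
  else 0.

Definition lap_pdf {R : realType} (b : R) (x : R) : R := expR (- `|x| / b) / (2 * b).

Definition lap_tail {R : realType} (b t : R) : R :=
  Rintegral (@lebesgue_measure R) `]t, +oo[%classic (lap_pdf b).

(* Step (1): Pr[V_1 = A], the events {d(v) + Lap_v > d} being independent *)
Definition pV1 {R : realType} n (e : rel 'I_n) (eps alpha : R) (A : {set 'I_n}) : R :=
  let dd := 24 / eps `^ (1 + alpha) in
  let b := 12 / eps in
  \prod_(v : 'I_n)
    (if v \in A then lap_tail b (dd - (deg e v)%:R)
     else 1 - lap_tail b (dd - (deg e v)%:R)).

Definition pE2 {R : realType} n (q : R) (Et E2 : {set 'I_n * 'I_n}) : R :=
  if E2 \subset Et then q ^+ #|E2| * (1 - q) ^+ (#|Et| - #|E2|) else 0.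

Definition nbr n (E2 : {set 'I_n * 'I_n}) (v : 'I_n) : {set 'I_n} :=
  [set u | ((v, u) \in E2) || ((u, v) \in E2)].

(* each v in V2 picks a uniform neighbour in (V2,E2), None (= bottom) if isolated;
   f v = None for v outside V2 (irrelevant convention) *)
Definition pf {R : realType} n (V2 : {set 'I_n}) (E2 : {set 'I_n * 'I_n})
    (f : {ffun 'I_n -> option 'I_n}) : R :=
  \prod_(v : 'I_n)
    (if v \in V2 then
       (if #|nbr E2 v| == 0%N then (f v == None)%:R
        else if f v is Some u then (u \in nbr E2 v)%:R / (#|nbr E2 v|)%:R else 0)
     else (f v == None)%:R).

Definition EM n (E2 : {set 'I_n * 'I_n}) (f : {ffun 'I_n -> option 'I_n}) :=
  [set p in E2 | (f p.1 == Some p.2) && (f p.2 == Some p.1)].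

Definition final_val {R : realType} n (e : rel 'I_n) (eps : R)
    (S1 S2 S3 : {ffun 'I_n -> bool}) : R :=
  let w S := expR (eps / 4 * (val (edge_set e) S)%:R) in
  (w S1 * (val (edge_set e) S1)%:R + w S2 * (val (edge_set e) S2)%:R
     + w S3 * (val (edge_set e) S3)%:R) / (w S1 + w S2 + w S3).

Definition alg_expect {R : realType} n (e : rel 'I_n) (eps alpha : R) : R :=
  let E := edge_set e in
  let q := eps `^ (1 + alpha) / 70 in
  \sum_(V1 : {set 'I_n}) pV1 e eps alpha V1 *
  \sum_(E2 : {set 'I_n * 'I_n}) pE2 q (induced E (~: V1)) E2 *
  \sum_(f : {ffun 'I_n -> option 'I_n}) pf (~: V1) E2 f *
  \sum_(S1 : {ffun 'I_n -> bool})
     (expmech V1 (eps / 12) (induced E V1) (restr V1 S1) * (2^-1) ^+ #|~: V1|) *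
  \sum_(S2 : {ffun 'I_n -> bool})
     (expmech (~: V1) ((5 / 2) / 4) (EM E2 f) (restr (~: V1) S2) * (2^-1) ^+ #|V1|) *
  final_val e eps S1 S2 [ffun v => v \in V1].

(* Main.v *)
Require Import Defs.
From HB Require Import structures.
From mathcomp Require Import all_boot all_order all_algebra.
From mathcomp Require Import all_classical all_reals all_analysis.
From mathcomp Require Import measurable_realfun.
From mathcomp Require Import ring lra.
Set Implicit Arguments. Unset Strict Implicit. Unset Printing Implicit Defensive.
Import Order.TTheory GRing.Theory Num.Theory.
Local Open Scope ring_scope.

(* Write m for the number of edges and d = eps^(1+alpha) = eps * eta.  The
   exponential mechanism of step (6) loses at most 8/eps against each of the three
   candidates, which is O(sqrt m) because m eps^2 >= C.  For small d this loss
   cannot be absorbed by a gain of order d m, so a gain of order sqrt m is needed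
   as well.  It comes from the independence of S_1 and S_2 given V_1:
   E max(v_1, v_2) = (E v_1 + E v_2 + E|v_1 - v_2|) / 2, and on the edges inside V_2
   the value of S_1 is a Rademacher chaos of degree 2, whose mean absolute deviation
   is at least of order sqrt m by Bonami's fourth-moment inequality.

   Given V_1, S_1 always has expected value at least m/2, and some candidate does
   better.  If many edges lie inside V_1, S_1 gains
   linearly, since the Gibbs measure is within 12 |V_1| / eps of the optimum (only
   non-isolated vertices count) and V_1 mostly consists of vertices of degree at least
   of order 1/d.  If many edges cross, S_3 gains linearly.  Otherwise S_2 gains a
   constant per matched edge, and an edge whose endpoints have degree O(1/d) is
   matched with probability of order d; together with the chaos this is of order
   sqrt m + d m.  Averaging over V_1 uses only the exponential tails of the Laplace
   noise.  If OPT < 0.99 m there is nothing to gain. *)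

Local Notation val := Defs.val.
Local Notation induced := Defs.induced.
Local Notation EM := Defs.EM.

(** * Moments of quadratic Rademacher chaos *)

Section Average.
Context {R : realType} {n : nat}.
Local Notation cut := {ffun 'I_n -> bool}.
Implicit Types (S T : cut) (A B : {set 'I_n}) (f g : cut -> R).

Definition avg f : R := (\sum_S f S) / #|{: cut}|%:R.

Lemma card_cut_gt0 : 0 < #|{: cut}|%:R :> R.
Proof. by rewrite ltr0n; apply/card_gt0P; exists [ffun=> true]. Qed.

Lemma avgD f g : avg (fun S => f S + g S) = avg f + avg g.
Proof. by rewrite /avg big_split mulrDl. Qed.

Lemma avgZ a f : avg (fun S => a * f S) = a * avg f.
Proof. by rewrite /avg -big_distrr /= mulrA. Qed.

Lemma avg_cst a : avg (fun=> a) = a.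
Proof.
rewrite /avg sumr_const -[a *+ _]mulr_natr mulfK // gt_eqF //; exact: card_cut_gt0.
Qed.

Lemma ler_avg f g : (forall S, f S <= g S) -> avg f <= avg g.
Proof.
move=> fg; rewrite ler_pM2r ?invr_gt0 ?card_cut_gt0 //; exact: ler_sum.
Qed.

Lemma eq_avg f g : f =1 g -> avg f = avg g.
Proof. by move=> fg; rewrite /avg (eq_bigr g). Qed.

(** Reversing the side of every vertex of [B]. These involutions preserve the uniform measure, and
    also a Gibbs measure when no edge of its graph leaves [B]; the symmetry arguments below rest on
    them. *)
Definition flip B S : cut := [ffun v => (v \in B) (+) S v].

Lemma flipK B : involutive (flip B).
Proof. by move=> S; apply/ffunP=> v; rewrite !ffunE addbA addbb. Qed.

Lemma sum_flip B f : \sum_S f (flip B S) = \sum_S f S.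
Proof. by rewrite [RHS](reindex_inj (inv_inj (flipK B))). Qed.

Lemma avg_flip B f : avg (fun S => f (flip B S)) = avg f.
Proof. by rewrite /avg sum_flip. Qed.

Definition sgn S v : R := (-1) ^+ S v.

Lemma sgn_flip B S v : sgn (flip B S) v = (if v \in B then - sgn S v else sgn S v).
Proof. by rewrite /sgn ffunE; case: (v \in B); case: (S v); rewrite /= ?expr0 ?expr1 ?opprK. Qed.

Lemma sgn2 S v : sgn S v ^+ 2 = 1.
Proof. by rewrite /sgn -exprM mulnC exprM sqrrN !expr1n. Qed.

Lemma avg_sgnM v f : (forall S, f (flip [set v] S) = f S) ->
  avg (fun S => sgn S v * f S) = 0.
Proof.
move=> fv; suff E : avg (fun S => sgn S v * f S) = - avg (fun S => sgn S v * f S).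
  by lra.
rewrite -[LHS](avg_flip [set v]) -mulN1r -avgZ; apply: eq_avg => S.
by rewrite sgn_flip inE eqxx fv mulN1r mulNr.
Qed.

Lemma avg_cauchy f g :
  avg (fun S => f S * g S) ^+ 2 <= avg (fun S => f S ^+ 2) * avg (fun S => g S ^+ 2).
Proof.
set P := avg _; set F := avg (fun S => f S ^+ 2); set G := avg _.
have F0 : 0 <= F by rewrite -[0]avg_cst; apply: ler_avg => S; rewrite sqr_ge0.
have H a b : 0 <= a ^+ 2 * F + b ^+ 2 * G - 2 * a * b * P.
  have -> : a ^+ 2 * F + b ^+ 2 * G - 2 * a * b * P = avg (fun S => (a * f S - b * g S) ^+ 2).
    rewrite /F /G /P -mulNr -!avgZ -!avgD; apply: eq_avg => S; ring.
  by rewrite -[0]avg_cst; apply: ler_avg => S; rewrite sqr_ge0.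
have [F_gt0|] := ltP 0 F.
  have := H P F; have -> : P ^+ 2 * F + F ^+ 2 * G - 2 * P * F * P = F * (F * G - P ^+ 2) by ring.
  by rewrite pmulr_rge0 // subr_ge0.
move=> Fle; have F00 : F = 0 by lra.
have [->|Pn0] := eqVneq P 0; first by rewrite F00 expr0n mul0r.
(* Degenerate case [F = 0]: with these coefficients the nonnegative form would equal -1. *)
have := H ((G + 1) / (2 * P)) 1.
have -> : 2 * ((G + 1) / (2 * P)) * 1 * P = G + 1 by field.
by rewrite F00; lra.
Qed.

(* Second moment [V] with a fourth-moment bound, the form of hypercontractivity
   that is stable under adding an independent sign. *)
Definition moments (K : R) f (V : R) :=
  avg (fun S => f S ^+ 2) = V /\ avg (fun S => f S ^+ 4) <= (K * V) ^+ 2.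

Lemma moments_ge0 K f V : moments K f V -> 0 <= V.
Proof. by case=> <- _; rewrite -[0]avg_cst; apply: ler_avg => S; rewrite sqr_ge0. Qed.

(* Bonami's induction step *)
Lemma moments_step (K K' : R) v f g V W : 0 <= K' -> 3 * K' <= K ->
  (forall S, f (flip [set v] S) = f S) -> (forall S, g (flip [set v] S) = g S) ->
  moments K f V -> moments K' g W ->
  moments K (fun S => f S + sgn S v * g S) (V + W).
Proof.
move=> K'0 KK' fv gv mf mg; have V0 := moments_ge0 mf; have W0 := moments_ge0 mg.
case: mf mg => f2 f4 [g2 g4]; split.
  rewrite -f2 -g2 -avgD.
  rewrite [LHS](_ : _ = avg (fun S => f S ^+ 2 + g S ^+ 2) +
                   avg (fun S => sgn S v * (2 * f S * g S))).
    by rewrite avg_sgnM ?addr0 // => S; rewrite fv gv.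
  rewrite -avgD; apply: eq_avg => S.
  have -> : (f S + sgn S v * g S) ^+ 2 =
    f S ^+ 2 + sgn S v ^+ 2 * g S ^+ 2 + sgn S v * (2 * f S * g S) by ring.
  by rewrite sgn2 mul1r.
rewrite [leLHS](_ : _ = avg (fun S => f S ^+ 4 + 6 * (f S ^+ 2 * g S ^+ 2) + g S ^+ 4) +
                   avg (fun S => sgn S v * (4 * f S ^+ 3 * g S + 4 * f S * g S ^+ 3))); last first.
  rewrite -avgD; apply: eq_avg => S; set s := sgn S v.
  have -> : (f S + s * g S) ^+ 4 =
    f S ^+ 4 + 6 * s ^+ 2 * (f S ^+ 2 * g S ^+ 2) + (s ^+ 2) ^+ 2 * g S ^+ 4
    + s * (4 * f S ^+ 3 * g S + s ^+ 2 * 4 * f S * g S ^+ 3) by ring.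
  by rewrite sgn2; ring.
rewrite avg_sgnM ?addr0 => [|S]; last by rewrite fv gv.
rewrite !avgD avgZ.
have := avg_cauchy (fun S => f S ^+ 2) (fun S => g S ^+ 2).
have sq4 (h : cut -> R) : avg (fun S => (h S ^+ 2) ^+ 2) = avg (fun S => h S ^+ 4).
  by apply: eq_avg => S; rewrite -exprM.
rewrite !sq4; set P := avg (fun S => _ * _); move=> cs.
have K0 : 0 <= K by lra.
have PK : P <= K * V * (K' * W).
  rewrite -[leRHS]ger0_norm ?mulr_ge0 //; apply: le_trans (ler_norm P) _.
  rewrite -ler_sqr ?nnegrE // !real_normK ?num_real //; apply: le_trans cs _.
  rewrite exprMn; apply: ler_pM => //.
  - by rewrite -[0]avg_cst; apply: ler_avg => S; rewrite exprn_even_ge0.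
  - by rewrite -[0]avg_cst; apply: ler_avg => S; rewrite exprn_even_ge0.
have : (K' * W) ^+ 2 <= (K * W) ^+ 2.
  rewrite ler_sqr ?nnegrE ?mulr_ge0 //; apply: ler_wpM2r => //; lra.
(* The mixed term enters the fourth moment with coefficient 6; [3 * K' <= K] reduces it to the cross
   term of the square of [K * (V + W)]. *)
have : 3 * (K * V * (K' * W)) <= K * K * (V * W).
  have -> : 3 * (K * V * (K' * W)) = (3 * K') * (K * (V * W)) by ring.
  by rewrite -(mulrA K K); apply: ler_wpM2r => //; rewrite !mulr_ge0.
have -> : (K * (V + W)) ^+ 2 = (K * V) ^+ 2 + 2 * (K * K * (V * W)) + (K * W) ^+ 2 by ring.
lra.
Qed.

Lemma eq_moments K f g V : f =1 g -> moments K f V -> moments K g V.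
Proof.
by move=> fg [f2 f4]; split; [rewrite -f2 | apply: le_trans f4; rewrite le_eqVlt;
  apply/orP; left; apply/eqP]; apply: eq_avg => S; rewrite fg.
Qed.

Lemma moments0 K : moments K (fun=> 0) 0.
Proof. by split; rewrite ?expr0n /= avg_cst // mulr0 expr0n. Qed.

Lemma moments1 (b : bool) : moments 1 (fun=> b%:R) b%:R.
Proof. by split; rewrite avg_cst; case: b; rewrite /= ?mulr1 ?mulr0 ?expr1n ?expr0n. Qed.

(** Signs are added in the order of their indices. The coefficient of a new sign is a constant, of
    moment constant 1, so 3 suffices for linear forms. *)
Lemma moments_lin (b : pred 'I_n) k :
  moments 3 (fun S => \sum_(u < n | (u < k)%N && b u) sgn S u) (\sum_(u < n | (u < k)%N && b u) 1).
Proof.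
elim: k => [|k IH].
  rewrite big_pred0 //; apply: eq_moments (moments0 3) => S; by rewrite big_pred0.
have [kn|nk] := ltnP k n; last first.
  rewrite (eq_bigl (fun u : 'I_n => (u < k)%N && b u)) => [|u].
    apply: eq_moments IH => S; apply: eq_bigl => u.
    by rewrite !(leq_trans (ltn_ord u)) // ltnW // ltnS.
  by rewrite !(leq_trans (ltn_ord u)) // ltnW // ltnS.
pose v := Ordinal kn.
have split_v (F : 'I_n -> R) : \sum_(u < n | (u < k.+1)%N && b u) F u =
    \sum_(u < n | (u < k)%N && b u) F u + F v * (b v)%:R.
  rewrite (bigID (fun u => u == v)) /= addrC; congr (_ + _).
    apply: eq_bigl => u; rewrite -val_eqE /= ltnS leq_eqVlt.
    by case: (ltngtP u k); rewrite ?andbF ?andbT.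
  case: (boolP (b v)) => bv; rewrite ?mulr1 ?mulr0.
    by apply: big_pred1 => u /=; case: eqVneq => [->|_]; rewrite ?andbF // bv /= ltnSn.
  by rewrite big_pred0 // => u; case: eqVneq => [->|_]; rewrite ?andbF // (negbTE bv) andbF.
rewrite split_v mul1r.
apply: (@eq_moments _ (fun S => \sum_(u < n | (u < k)%N && b u) sgn S u + sgn S v * (b v)%:R)) => [S|].
  by rewrite split_v.
apply: moments_step IH (moments1 (b v)) => //; first lra.
move=> S; apply: eq_bigr => u /andP[uk _]; rewrite sgn_flip inE.
by case: eqVneq uk => // ->; rewrite ltnn.
Qed.

Definition chaos (H : {set 'I_n * 'I_n}) S : R := \sum_(p in H) sgn S p.1 * sgn S p.2.

(** Edges are added by their larger endpoint [v]: the new ones contribute the sign of [v] times a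
    linear form in earlier signs. Linear forms have constant 3, so [9 = 3 * 3] is enough. *)
Lemma moments_chaos (H : {set 'I_n * 'I_n}) : (forall p, p \in H -> (p.1 < p.2)%N) ->
  moments 9 (chaos H) #|H|%:R.
Proof.
move=> Hlt.
suff: forall k, moments 9 (fun S => \sum_(p in H | (p.2 < k)%N) sgn S p.1 * sgn S p.2)
    (\sum_(p in H | (p.2 < k)%N) 1).
  move/(_ n); rewrite (eq_bigl (mem H)) => [|p]; last by rewrite ltn_ord andbT.
  rewrite sumr_const; apply: eq_moments => S; apply: eq_bigl => p; by rewrite ltn_ord andbT.
elim=> [|k IH].
  rewrite big_pred0 => [|p]; last by rewrite andbF.
  apply: eq_moments (moments0 9) => S; by rewrite big_pred0 // => p; rewrite andbF.
have [kn|nk] := ltnP k n; last first.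
  have E (p : 'I_n * 'I_n) : (p \in H) && (p.2 < k.+1)%N = (p \in H) && (p.2 < k)%N.
    by rewrite !(leq_trans (ltn_ord _)) // ltnW // ltnS.
  by rewrite (eq_bigl _ _ E); apply: eq_moments IH => S; rewrite (eq_bigl _ _ E).
pose v := Ordinal kn.
pose b u := (u, v) \in H.
have split_v (F : 'I_n * 'I_n -> R) : \sum_(p in H | (p.2 < k.+1)%N) F p =
    \sum_(p in H | (p.2 < k)%N) F p + \sum_(u < n | (u < k)%N && b u) F (u, v).
  rewrite (bigID (fun p => p.2 == v)) /= addrC; congr (_ + _).
    apply: eq_bigl => p; rewrite -val_eqE /= ltnS leq_eqVlt.
    by case: (ltngtP p.2 k); rewrite ?andbF ?andbT.
  rewrite (reindex_onto (fun u => (u, v)) fst) => [|[u w] /andP[_ /eqP /= ->]//].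
  apply: eq_bigl => u /=; rewrite !eqxx ltnSn !andbT /b.
  by case: (boolP ((u, v) \in H)) => [/Hlt /= ->|]; rewrite ?andbF.
rewrite split_v.
apply: (@eq_moments _ (fun S => \sum_(p in H | (p.2 < k)%N) sgn S p.1 * sgn S p.2 +
   sgn S v * \sum_(u < n | (u < k)%N && b u) sgn S u)) => [S|].
  rewrite split_v big_distrr /=; congr (_ + _); apply: eq_bigr => u _; exact: mulrC.
apply: moments_step IH (moments_lin b k) => //; first by lra.
- move=> S; apply: eq_bigr => p /andP[/Hlt p12 p2k].
  rewrite !sgn_flip !inE -!val_eqE /= (ltn_eqF p2k) ltn_eqF //; exact: ltn_trans p2k.
- move=> S; apply: eq_bigr => u /andP[uk _]; by rewrite sgn_flip inE -val_eqE /= ltn_eqF.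
Qed.

Lemma avg_chaos (H : {set 'I_n * 'I_n}) : (forall p, p \in H -> (p.1 < p.2)%N) -> avg (chaos H) = 0.
Proof.
move=> Hlt; rewrite /avg exchange_big /=; rewrite big1 ?mul0r // => p /Hlt p12.
suff: avg (fun S => sgn S p.1 * sgn S p.2) = 0.
  by rewrite /avg => /eqP; rewrite mulf_eq0 invr_eq0 (gt_eqF card_cut_gt0) orbF => /eqP.
apply: avg_sgnM => S; by rewrite sgn_flip inE -val_eqE /= gtn_eqF.
Qed.

(** A polynomial minorant of the absolute value, turning the second and fourth moments into a lower
    bound on the first absolute moment. *)
Lemma norm_poly_lb (K x : R) : 0 < K -> x ^+ 2 / K - x ^+ 4 / (4 * K ^+ 3) <= `|x|.
Proof.
move=> K0; have -> : x ^+ 2 = `|x| ^+ 2 by rewrite real_normK ?num_real.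
have -> : x ^+ 4 = `|x| ^+ 4 by rewrite -[RHS]normrX ger0_norm // exprn_even_ge0.
set y := `|x|; have y0 : 0 <= y := normr_ge0 x.
pose t := y / K; have -> : y = t * K by rewrite /t; field; rewrite gt_eqF.
have t0 : 0 <= t by rewrite divr_ge0 // ltW.
have -> : (t * K) ^+ 2 / K - (t * K) ^+ 4 / (4 * K ^+ 3) = (t * (t - t ^+ 3 / 4)) * K.
  by field; rewrite gt_eqF.
apply: ler_wpM2r; first exact: ltW.
rewrite -[leRHS]mulr1; apply: ler_wpM2l => //.
have : 0 <= (t - 1) ^+ 2 * (t + 2) by rewrite mulr_ge0 ?sqr_ge0 //; lra.
nra.
Qed.

(** Shifting by [a] costs a factor two: [f] has mean zero, so Jensen gives [|a| <= avg |f - a|], and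
    the triangle inequality then gives [avg |f| <= 2 * avg |f - a|]. *)
Lemma avg_norm_ge f V a : 0 <= V -> moments 9 f V -> avg f = 0 ->
  7 / 200 * Num.sqrt V <= avg (fun S => `|f S - a|).
Proof.
move=> V0 [f2 f4] f0.
have [V00|Vn0] := eqVneq V 0.
  by rewrite V00 sqrtr0 mulr0 -[0]avg_cst; apply: ler_avg.
have Vgt : 0 < V by rewrite lt_neqAle eq_sym Vn0.
set r := Num.sqrt V; have r0 : 0 < r by rewrite sqrtr_gt0.
have r2 : r ^+ 2 = V by rewrite sqr_sqrtr.
have E1 : 7 / 100 * r <= avg (fun S => `|f S|).
  (* With scale [6 * r] the two moment terms are [r / 6] and at most [81 / 864 * r]; their
     difference exceeds [7 / 100 * r]. *)
  have K0 : 0 < 6 * r by lra.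
  apply: le_trans (ler_avg (fun S => norm_poly_lb (f S) K0)).
  rewrite (@eq_avg _ (fun S => (6 * r)^-1 * f S ^+ 2 + - (4 * (6 * r) ^+ 3)^-1 * f S ^+ 4)); last first.
    by move=> S; rewrite mulNr; congr (_ - _); rewrite mulrC.
  rewrite avgD !avgZ f2.
  have : avg (fun S => f S ^+ 4) <= 81 * r ^+ 4.
    by apply: le_trans f4 _; rewrite -r2 le_eqVlt; apply/orP; left; apply/eqP; ring.
  set F := avg _ => F4.
  have : (4 * (6 * r) ^+ 3)^-1 * F <= (4 * (6 * r) ^+ 3)^-1 * (81 * r ^+ 4).
    by apply: ler_wpM2l => //; rewrite invr_ge0 mulr_ge0 // exprn_ge0 // ltW.
  have -> : (4 * (6 * r) ^+ 3)^-1 * (81 * r ^+ 4) = 81 / 864 * r by field; rewrite gt_eqF.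
  have -> : (6 * r)^-1 * V = r / 6 by rewrite -r2; field; rewrite gt_eqF.
  rewrite mulNr; lra.
have E2 : `|a| <= avg (fun S => `|f S - a|).
  have -> : `|a| = `|avg (fun S => f S - a)| by rewrite avgD avg_cst f0 sub0r normrN.
  rewrite /avg normrM (gtr0_norm (x := _^-1)) ?invr_gt0 ?card_cut_gt0 //.
  by rewrite ler_pM2r ?invr_gt0 ?card_cut_gt0 // ler_norm_sum.
have E3 : avg (fun S => `|f S|) <= avg (fun S => `|f S - a|) + `|a|.
  rewrite -[X in _ + X]avg_cst -avgD; apply: ler_avg => S.
  by rewrite -[f S in leLHS](subrK a) ler_normD.
lra.
Qed.

End Average.

(** * Gibbs measures on cuts *)

Section Gibbs.
Context {R : realType} {n : nat}.
Local Notation cut := {ffun 'I_n -> bool}.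
Local Notation edges := {set 'I_n * 'I_n}.
Implicit Types (S T : cut) (A B : {set 'I_n}) (f g : cut -> R) (E H : edges) (b : R).

Lemma valE H S : (val H S)%:R = \sum_(p in H) (S p.1 != S p.2)%:R :> R.
Proof.
rewrite /Defs.val -sum1_card natr_sum big_mkcond [RHS]big_mkcond /=.
by apply: eq_bigr => p _; rewrite inE; case: (p \in H) => //=; case: (_ != _).
Qed.

Lemma val_flip B H S : {in H, forall p, (p.1 \in B) = (p.2 \in B)} ->
  val H (flip B S) = val H S.
Proof.
move=> HB; apply: eq_card => p; rewrite !inE !ffunE.
by case: (boolP (p \in H)) => // /HB ->; case: (p.2 \in B) => //=; case: (S _); case: (S _).
Qed.

Lemma val_le H S : (val H S <= #|H|)%N.
Proof. by apply: subset_leq_card; apply/fintype.subsetP => p; rewrite inE => /andP[]. Qed.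

Definition weight b H S : R := expR (b * (val H S)%:R).

Definition partition_fun b H : R := \sum_S weight b H S.

(** The Gibbs average runs over cuts of the whole vertex set, not only of the vertices of [H].
    Coordinates that meet no edge of [H] are then uniform and independent, which builds in the
    concatenations of step (5). *)
Definition gexp b H f : R := (\sum_S weight b H S * f S) / partition_fun b H.

Lemma weight_gt0 b H S : 0 < weight b H S. Proof. exact: expR_gt0. Qed.

Lemma partition_gt0 b H : 0 < partition_fun b H.
Proof.
rewrite /partition_fun (bigD1 [ffun=> true]) //= ltr_pwDl ?weight_gt0 //.
by apply: sumr_ge0 => S _; apply/ltW/weight_gt0.
Qed.

Lemma gexpD b H f g : gexp b H (fun S => f S + g S) = gexp b H f + gexp b H g.
Proof.
by rewrite /gexp -mulrDl -big_split; congr (_ / _); apply: eq_bigr => S _; rewrite mulrDr.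
Qed.

Lemma gexpZ b H a f : gexp b H (fun S => a * f S) = a * gexp b H f.
Proof.
by rewrite /gexp mulrA big_distrr; congr (_ / _); apply: eq_bigr => S _; rewrite mulrCA.
Qed.

Lemma gexp_cst b H a : gexp b H (fun=> a) = a.
Proof. by rewrite /gexp -big_distrl /= mulrAC divff ?mul1r // gt_eqF ?partition_gt0. Qed.

Lemma ler_gexp b H f g : (forall S, f S <= g S) -> gexp b H f <= gexp b H g.
Proof.
move=> fg; rewrite ler_pM2r ?invr_gt0 ?partition_gt0 //; apply: ler_sum => S _.
by rewrite ler_pM2l ?weight_gt0.
Qed.

Lemma eq_gexp b H f g : f =1 g -> gexp b H f = gexp b H g.
Proof. by move=> fg; congr (_ / _); apply: eq_bigr => S _; rewrite fg. Qed.

Lemma gexp_sum b H (I : finType) (P : pred I) (F : I -> cut -> R) :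
  gexp b H (fun S => \sum_(i | P i) F i S) = \sum_(i | P i) gexp b H (F i).
Proof.
rewrite /gexp -big_distrl; congr (_ / _); rewrite exchange_big /=.
by apply: eq_bigr => S _; rewrite big_distrr.
Qed.

Lemma gexp_flip b H B f : {in H, forall p, (p.1 \in B) = (p.2 \in B)} ->
  gexp b H (fun S => f (flip B S)) = gexp b H f.
Proof.
move=> HB; congr (_ / _); rewrite -[RHS](sum_flip B); apply: eq_bigr => S _.
by rewrite /weight val_flip.
Qed.

(** Jensen's inequality, from the tangent line of the exponential at the mean. *)
Lemma gexp_expR b H f : expR (gexp b H f) <= gexp b H (fun S => expR (f S)).
Proof.
set a := gexp b H f.
have -> : expR a = gexp b H (fun S => expR a * (1 - a + f S)).
  by rewrite gexpZ gexpD gexp_cst -/a subrK mulr1.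
apply: ler_gexp => S; apply: (@le_trans _ _ (expR a * expR (f S - a))).
  by rewrite ler_pM2l ?expR_gt0 //; have := expR_ge1Dx (f S - a); lra.
by rewrite -expRD addrC subrK.
Qed.

(** No edge of [H] leaves [B], so flipping [B] preserves the measure; it also toggles whether [p] is
    cut. *)
Lemma gexp_cut_half b H B (p : 'I_n * 'I_n) :
  {in H, forall p, (p.1 \in B) = (p.2 \in B)} -> (p.1 \in B) != (p.2 \in B) ->
  gexp b H (fun S => (S p.1 != S p.2)%:R) = 2^-1.
Proof.
move=> HB pB; set x := gexp _ _ _.
suff : x = 1 - x by lra.
rewrite -[LHS](@gexp_flip b H B _ HB) -[X in X - _](gexp_cst b H) -mulN1r -gexpZ -gexpD.
apply: eq_gexp => S; rewrite !ffunE mulN1r.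
case: (_ \in _) pB; case: (_ \in _) => // _; case: (S p.1); case: (S p.2); rewrite /= ?mulr1n ?mulr0n; lra.
Qed.

Lemma val_flip_edge H (p : 'I_n * 'I_n) S : p \in H -> p.1 != p.2 ->
  {in H, forall p', p' != p -> (p'.1 != p.1) && (p'.2 != p.1)} -> S p.1 == S p.2 ->
  val H (flip [set p.1] S) = (val H S).+1.
Proof.
move=> pH p12 Hp Sp; rewrite /Defs.val (cardsD1 p) !inE pH !ffunE !inE eqxx.
rewrite (eq_sym p.2) (negbTE p12) /= (eqP Sp) (_ : true (+) _ != false (+) _) ?addTb ?addFb; last by case: (S p.2).
rewrite add1n; congr _.+1; apply: eq_card => p'; rewrite !inE !ffunE !inE.
case: eqVneq => [->|pp] /=; first by rewrite Sp andbF.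
by case: (boolP (p' \in H)) => // /Hp /(_ pp) /andP[/negbTE -> /negbTE ->].
Qed.

(** As [p] is the only edge of [H] at [p.1], flipping that vertex pairs each cut missing [p] with
    one cutting it, of weight larger by the factor [expR b]. The bound follows from
    [expR b >= 1 + b]. *)
Lemma gexp_matched b H (p : 'I_n * 'I_n) : 0 <= b -> p \in H -> p.1 != p.2 ->
  {in H, forall p', p' != p -> (p'.1 != p.1) && (p'.2 != p.1)} ->
  (1 + b) / (2 + b) <= gexp b H (fun S => (S p.1 != S p.2)%:R).
Proof.
move=> b0 pH p12 Hp.
set x := gexp _ _ _; pose y := gexp b H (fun S => (S p.1 == S p.2)%:R).
have xy : x + y = 1.
  rewrite -[RHS](gexp_cst b H) -gexpD; apply: eq_gexp => S.
  by case: (_ == _); rewrite /= ?addr0 ?add0r.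
suff xe : x = expR b * y.
  have y0 : 0 <= y by rewrite -[0](gexp_cst b H); apply: ler_gexp.
  have : (1 + b) * y <= expR b * y by rewrite ler_wpM2r // expR_ge1Dx.
  rewrite -xe ler_pdivrMr; last by lra.
  have -> : y = 1 - x by lra.
  nra.
rewrite /x /y -gexpZ; congr (_ / _); rewrite -[LHS](sum_flip [set p.1]).
apply: eq_bigr => S _; rewrite !ffunE !inE eqxx (eq_sym p.2) (negbTE p12).
case: (boolP (S p.1 == S p.2)) => Sp.
  rewrite /weight val_flip_edge // -natr1 mulrDr mulr1 expRD (eqP Sp).
  by case: (S p.2); rewrite /= !mulr1.
by move: Sp; case: (S p.1); case: (S p.2); rewrite //= !mulr0.
Qed.

(** Chebyshev's association inequality: the weight increases with the value, so the Gibbs mean is at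
    least the uniform mean, which is half the number of edges. *)
Lemma gexp_val_ge_half b H : 0 <= b -> {in H, forall p, p.1 != p.2} ->
  #|H|%:R / 2 <= gexp b H (fun S => (val H S)%:R).
Proof.
move=> b0 H12; pose x S : R := (val H S)%:R.
have avx : avg x = #|H|%:R / 2.
  have -> : avg x = gexp 0 H x.
    rewrite /avg /gexp /partition_fun /weight; congr (_ / _).
      by apply: eq_bigr => S _; rewrite mul0r expR0 mul1r.
    rewrite -sum1_card natr_sum; apply: eq_bigr => S _; by rewrite mul0r expR0.
  (* At [b = 0] the edge set is immaterial; for the empty one every vertex set may be flipped. *)
  have -> : gexp 0 H x = gexp 0 finset.set0 x.
    congr (_ / _); rewrite /partition_fun; apply: eq_bigr => S _; by rewrite /weight !mul0r.
  rewrite (eq_gexp _ _ (valE H)) gexp_sum (eq_bigr (fun=> 2^-1)).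
    by rewrite sumr_const -[2^-1 *+ _]mulr_natl.
  move=> p /H12 p12; apply: (@gexp_cut_half 0 finset.set0 [set p.1]) => [q|]; first by rewrite inE.
  by rewrite !inE eqxx (eq_sym p.2) (negbTE p12).
rewrite -avx /gexp ler_pdivlMr ?partition_gt0 // /avg mulrAC.
rewrite ler_pdivrMr ?card_cut_gt0 //.
have C : 0 <= \sum_S \sum_T (weight b H S - weight b H T) * (x S - x T).
  apply: sumr_ge0 => S _; apply: sumr_ge0 => T _; rewrite /weight -!/(x _).
  have [le|/ltW le] := leP (x S) (x T).
    by apply: mulr_le0; rewrite subr_le0 // ler_expR ler_wpM2l.
  by apply: mulr_ge0; rewrite subr_ge0 // ler_expR ler_wpM2l.
set W := partition_fun b H; set X := \sum_S x S; set N := #|_|%:R; set P := \sum_S _ * _.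
suff : \sum_S \sum_T (weight b H S - weight b H T) * (x S - x T) = 2 * (P * N - X * W).
  by move=> E; move: C; rewrite E; lra.
have E1 S : \sum_T (weight b H S - weight b H T) * (x S - x T) =
    N * (weight b H S * x S) - weight b H S * X - W * x S + P.
  rewrite /X /W /P /partition_fun !big_distrr !big_distrl /= -!sumrN -[X in X * _](_ : \sum_(T : cut) 1 = N); last first.
    by rewrite sumr_const.
  rewrite big_distrl -!big_split /=; apply: eq_bigr => T _. rewrite -/(x T); ring.
rewrite (eq_bigr _ (fun S _ => E1 S)) !big_split /= !sumrN -!big_distrr -!big_distrl /=.
rewrite sumr_const -[P *+ _]mulr_natr -/N -/X -/P -/(partition_fun b H) -/W; ring.
Qed.

(** For every cut [S], exactly one flip inside [U] makes it agree with [T] on [U], and then it has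
    the weight of [T]. Summing over [S] and over all flips gives the bound. *)
Lemma weight_le_partition b H (U : {set 'I_n}) T :
  {in H, forall p, (p.1 \in U) && (p.2 \in U)} ->
  #|{: cut}|%:R * weight b H T <= 2 ^+ #|U| * partition_fun b H.
Proof.
move=> HU.
have -> : 2 ^+ #|U| * partition_fun b H = \sum_S \sum_(B in powerset U) weight b H (flip B S).
  rewrite exchange_big /= (eq_bigr (fun=> partition_fun b H)) => [|B _]; last exact: sum_flip.
  by rewrite sumr_const card_powerset -[RHS]mulr_natl natrX.
have -> : #|{: cut}|%:R * weight b H T = \sum_(S : cut) weight b H T.
  by rewrite sumr_const -[RHS]mulr_natl.
apply: ler_sum => S _; pose B := [set v in U | S v != T v].
have BU : B \in powerset U by rewrite powersetE; apply/fintype.subsetP => v; rewrite inE => /andP[].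
rewrite (bigD1 B) //=.
have -> : weight b H (flip B S) = weight b H T.
  rewrite /weight; congr (expR (_ * _%:R)); apply: eq_card => p; rewrite !inE !ffunE !inE.
  case: (boolP (p \in H)) => //= /HU /andP[-> ->] /=.
  by case: (S p.1); case: (S p.2); case: (T p.1); case: (T p.2).
by rewrite lerDl sumr_ge0 // => ? _; apply/ltW/weight_gt0.
Qed.

(** The utility bound of the exponential mechanism. The Gibbs mean of [expR (b * (val T - val S))]
    is at most [2 ^ #|U| <= expR #|U|], and Jensen moves the mean into the exponent. *)
Lemma gexp_val_ge b H (U : {set 'I_n}) T : 0 < b ->
  {in H, forall p, (p.1 \in U) && (p.2 \in U)} ->
  (val H T)%:R - #|U|%:R / b <= gexp b H (fun S => (val H S)%:R).
Proof.
move=> b0 HU; set x := gexp _ _ _.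
have J := gexp_expR b H (fun S => b * ((val H T)%:R - (val H S)%:R)).
have E1 : gexp b H (fun S => b * ((val H T)%:R - (val H S)%:R)) = b * ((val H T)%:R - x).
  rewrite gexpZ gexpD gexp_cst; congr (_ * (_ + _)).
  by rewrite -mulN1r -gexpZ; apply: eq_gexp => S; rewrite mulN1r.
have E2 : gexp b H (fun S => expR (b * ((val H T)%:R - (val H S)%:R))) <= 2 ^+ #|U|.
  rewrite /gexp ler_pdivrMr ?partition_gt0 //.
  apply: le_trans (weight_le_partition b T HU).
  rewrite (eq_bigr (fun=> weight b H T)) => [|S _]; last first.
    by rewrite /weight -expRD -mulrDr addrC subrK.
  by rewrite sumr_const -[_ *+ _]mulr_natl.
have E3 : 2 ^+ #|U| <= expR (#|U|%:R : R).
  rewrite -[X in expR X]mulr1 expRM_natl; apply: lerXn2r; rewrite ?nnegrE ?expR_ge0 //.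
  by have := @expR_ge1Dx R 1; lra.
move: J; rewrite E1 => /le_trans/(_ (le_trans E2 E3)); rewrite ler_expR.
rewrite mulrC -ler_pdivlMr //; lra.
Qed.

End Gibbs.

(** * The candidate cuts *)

Section Candidates.
Context {R : realType} {n : nat}.
Local Notation cut := {ffun 'I_n -> bool}.
Local Notation edges := {set 'I_n * 'I_n}.
Implicit Types (S T : cut) (A B : {set 'I_n}) (E H M : edges) (b : R).

Definition merge A S T : cut := [ffun v => if v \in A then S v else T v].

(** Exchanging the coordinates off [A] between two cuts is an involution on pairs; it serves to
    resample those coordinates uniformly. *)
Lemma sum_merge A (F : cut -> cut -> R) :
  \sum_S \sum_T F (merge A S T) (merge A T S) = \sum_S \sum_T F S T.
Proof.
rewrite !pair_big /= [RHS](reindex_inj (_ : injective (fun p => (merge A p.1 p.2, merge A p.2 p.1)))) //.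
apply: inv_inj => -[S T] /=; congr (_, _); apply/ffunP => v; rewrite !ffunE; by case: (v \in A).
Qed.

Lemma chaosE E S : chaos E S = #|E|%:R - 2 * (val E S)%:R :> R.
Proof.
rewrite valE -sum1_card natr_sum big_distrr -sumrB; apply: eq_bigr => p _.
by rewrite /sgn; case: (S p.1); case: (S p.2); rewrite /= ?expr0 ?expr1 ?mulr1n ?mulr0n; lra.
Qed.

(** The edges of [E] lie off [A], where the measure is uniform, while [psi] depends only on
    coordinates in [A]. Resampling off [A] makes [psi] a constant shift of a chaos; the value is
    minus half the chaos plus a constant, which halves [7 / 200]. *)
Lemma gexp_norm_ge b H A E (psi : cut -> R) :
  {in H, forall p, (p.1 \in A) && (p.2 \in A)} ->
  (forall p, p \in E -> (p.1 < p.2)%N) -> {in E, forall p, (p.1 \notin A) && (p.2 \notin A)} ->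
  (forall S T, {in A, S =1 T} -> psi S = psi T) ->
  7 / 400 * Num.sqrt #|E|%:R <= gexp b H (fun S => `|(val E S)%:R + psi S|).
Proof.
move=> HA Elt EA psiA; rewrite /gexp ler_pdivlMr ?partition_gt0 //.
rewrite -(ler_pM2r (@card_cut_gt0 R n)).
set c := _ * Num.sqrt _.
have -> : (\sum_S weight b H S * `|(val E S)%:R + psi S|) * #|{: cut}|%:R =
    \sum_S weight b H S * \sum_T `|(val E T)%:R + psi S|.
  transitivity (\sum_S \sum_(T : cut) weight b H S * `|(val E S)%:R + psi S|).
    by rewrite big_distrl; apply: eq_bigr => S _ /=; rewrite sumr_const mulr_natr.
  rewrite -(sum_merge A); apply: eq_bigr => S _; rewrite big_distrr; apply: eq_bigr => T _.
  have -> : weight b H (merge A S T) = weight b H S.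
    congr (expR (_ * _%:R)); apply: eq_card => p; rewrite !inE !ffunE.
    by case: (boolP (p \in H)) => // /HA /andP[-> ->].
  have -> : val E (merge A S T) = val E T.
    apply: eq_card => p; rewrite !inE !ffunE.
    by case: (boolP (p \in E)) => // /EA /andP[/negbTE -> /negbTE ->].
  by rewrite (psiA _ S) // => v vA; rewrite ffunE vA.
rewrite /partition_fun mulrAC mulrC big_distrl /=.
apply: ler_sum => S _; rewrite ler_pM2l ?weight_gt0 //.
have := avg_norm_ge (#|E|%:R + 2 * psi S) (ler0n _ _) (moments_chaos Elt) (avg_chaos Elt).
rewrite /avg ler_pdivlMr ?card_cut_gt0 // => cE.
suff -> : \sum_T `|(val E T)%:R + psi S| = (\sum_T `|chaos E T - (#|E|%:R + 2 * psi S)|) / 2.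
  by rewrite /c; lra.
rewrite big_distrl; apply: eq_bigr => T _ /=; rewrite chaosE.
have -> : #|E|%:R - 2 * (val E T)%:R - (#|E|%:R + 2 * psi S) = - (2 * ((val E T)%:R + psi S)) by ring.
by rewrite normrN normrM ger0_norm // mulrC mulKf.
Qed.

(** Cross edges depend on coordinates on both sides of [A]. Averaging over the flip of all of [A],
    which preserves the measure, replaces them by constants, and convexity of the absolute value
    makes this a lower bound. *)
Lemma gexp_dev b H A E (a : R) :
  {in H, forall p, (p.1 \in A) && (p.2 \in A)} -> (forall p, p \in E -> (p.1 < p.2)%N) ->
  7 / 400 * Num.sqrt #|induced E (~: A)|%:R <= gexp b H (fun S => `|(val E S)%:R - a|).
Proof.
move=> HA Elt; pose E2 := induced E (~: A).
(* [cr S p] is the average of the cut indicators of [p] under [S] and [flip A S];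
   the cross edges contribute 1/2. *)
pose cr S (p : 'I_n * 'I_n) : R :=
  if (p.1 \in A) == (p.2 \in A) then (S p.1 != S p.2)%:R else 2^-1.
pose psi S : R := \sum_(p in E :\: E2) cr S p - a.
have := @gexp_norm_ge b H A E2 psi HA.
have E2P p : p \in E2 -> [&& p \in E, p.1 \notin A & p.2 \notin A] by rewrite !inE.
move=> /(_ _ _ _)/le_trans; apply.
- by move=> p /E2P/and3P[/Elt].
- by move=> p /E2P/and3P[_ -> ->].
- move=> S T ST; rewrite /psi; congr (_ - _); apply: eq_bigr => p.
  rewrite !inE /cr negb_and => /andP[+ pE]; rewrite pE /=.
  by case: (boolP (p.1 \in A)) => p1; case: (boolP (p.2 \in A)) => p2 //=; rewrite !ST.
have HA' : {in H, forall p, (p.1 \in A) = (p.2 \in A)} by move=> p /HA /andP[-> ->].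
have -> : gexp b H (fun S => `|(val E S)%:R - a|) =
   gexp b H (fun S => 2^-1 * (`|(val E S)%:R - a| + `|(val E (flip A S))%:R - a|)).
  rewrite gexpZ gexpD (@gexp_flip _ _ b H A (fun S => `|(val E S)%:R - a|) HA'); lra.
apply: ler_gexp => S.
have -> : (val E2 S)%:R + psi S = 2^-1 * (((val E S)%:R - a) + ((val E (flip A S))%:R - a)).
  rewrite /psi !valE addrACA addrA.
  suff -> : \sum_(p in E) (S p.1 != S p.2)%:R + \sum_(p in E) (flip A S p.1 != flip A S p.2)%:R =
     2 * (\sum_(p in E2) (S p.1 != S p.2)%:R + \sum_(p in E :\: E2) cr S p) :> R by lra.
  have -> : \sum_(p in E2) (S p.1 != S p.2)%:R = \sum_(p in E2) cr S p.
    by apply: eq_bigr => p /E2P /and3P[_ /negbTE p1 /negbTE p2]; rewrite /cr p1 p2.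
  rewrite -big_split /=; transitivity (2 * \sum_(p in E) cr S p).
    rewrite big_distrr; apply: eq_bigr => p _; rewrite !ffunE /cr.
    by case: (_ \in A); case: (_ \in A); case: (S p.1); case: (S p.2); rewrite /= ?mulr1n ?mulr0n; lra.
  congr (_ * _); rewrite [LHS](bigID (mem E2)); congr (_ + _); apply: eq_bigl => p.
    by rewrite !inE; case: (p \in E).
  by rewrite !inE; case: (p \in E); rewrite ?andbT ?andbF.
by rewrite normrM ger0_norm ?invr_ge0 // ler_pM2l ?invr_gt0 // ler_normD.
Qed.

(** An edge not inside [A] has an endpoint isolated in [H]; flipping that vertex shows that the edge
    is cut with probability one half. *)
Lemma gexp_val_out b H A E : {in H, forall p, (p.1 \in A) && (p.2 \in A)} ->
  (forall p, p \in E -> (p.1 < p.2)%N) ->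
  gexp b H (fun S => (val E S)%:R) =
  gexp b H (fun S => (val (induced E A) S)%:R) + (#|E|%:R - #|induced E A|%:R) / 2.
Proof.
move=> HA Elt; rewrite !(eq_gexp _ _ (valE _)) !gexp_sum.
rewrite (bigID (mem (induced E A))) /=; congr (_ + _).
  by apply: eq_bigl => p; rewrite !inE; case: (p \in E).
have -> : #|E|%:R - #|induced E A|%:R = #|E :\: induced E A|%:R :> R.
  have /finset.setIidPr IE : induced E A \subset E.
    by apply/fintype.subsetP => p; rewrite inE => /andP[].
  by rewrite cardsD IE natrB //; apply: subset_leq_card; apply/finset.setIidPr.
rewrite (eq_bigr (fun=> 2^-1)) => [|p /andP[pE]].
  rewrite (eq_bigl (mem (E :\: induced E A))) => [|p]; last by rewrite !inE andbC.
  by rewrite sumr_const -[2^-1 *+ _]mulr_natl.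
have p12 : p.1 != p.2 by rewrite -val_eqE /= ltn_eqF // Elt.
rewrite !inE pE /= negb_and => /orP[pA|pA].
  apply: (@gexp_cut_half _ _ b H [set p.1]).
    move=> q /HA /andP[q1 q2]; rewrite !inE.
    by rewrite !(negbTE (memPn pA _ _)).
  by rewrite !inE eqxx (eq_sym p.2) (negbTE p12).
apply: (@gexp_cut_half _ _ b H [set p.2]).
  move=> q /HA /andP[q1 q2]; rewrite !inE.
  by rewrite !(negbTE (memPn pA _ _)).
by rewrite !inE eqxx (negbTE p12).
Qed.

(** Mutual choices are pairwise disjoint edges. Each is cut with probability at least
    [13 / 21 >= 1 / 2 + 1 / 10], and every other edge of [E] with probability exactly one half. *)
Lemma gexp_matching E E2 (f : {ffun 'I_n -> option 'I_n}) :
  (forall p, p \in E -> (p.1 < p.2)%N) -> E2 \subset E ->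
  #|E|%:R / 2 + #|EM E2 f|%:R / 10 <=
    gexp (5 / 2 / 4 : R) (EM E2 f) (fun S => (val E S)%:R).
Proof.
move=> Elt E2E; set M := EM E2 f.
have MP p : p \in M -> [/\ p \in E, (p.1 < p.2)%N, f p.1 = Some p.2 & f p.2 = Some p.1].
  rewrite inE => /and3P[/(fintype.subsetP E2E) pE /eqP f1 /eqP f2]; split=> //; exact: Elt.
clearbody M.
rewrite (eq_gexp _ _ (valE _)) gexp_sum.
have -> : #|E|%:R / 2 + #|M|%:R / 10 = \sum_(p in E) (2^-1 + (p \in M)%:R / 10) :> R.
  rewrite big_split sumr_const -[2^-1 *+ _]mulr_natl; congr (_ + _).
  rewrite -big_distrl -sum1_card natr_sum /=; congr (_ / _).
  rewrite [RHS]big_mkcond [LHS]big_mkcond; apply: eq_bigr => p _ /=.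
  by case: (boolP (p \in M)) => [/MP[-> //]|]; case: (p \in E).
apply: ler_sum => p pE; have p12 : p.1 != p.2 by rewrite -val_eqE /= ltn_eqF // Elt.
case: (boolP (p \in M)) => pM.
  apply: (@le_trans _ _ ((1 + 5 / 2 / 4) / (2 + 5 / 2 / 4))); first by rewrite (_ : true%:R = 1 :> R) // ler_pdivlMr; lra.
  apply: gexp_matched => //.
  have [_ _ p1 p2] := MP _ pM.
  move=> q /MP[_ q12 q1 q2] qp; apply/andP; split; apply: contraNneq qp => qp1.
    by rewrite [q]surjective_pairing [p]surjective_pairing qp1; move: q1; rewrite qp1 p1 => -[->].
  move: q2; rewrite qp1 p1 => -[pq]; move: q12; rewrite qp1 -pq => q12.
  by have := ltn_trans q12 (Elt _ pE); rewrite ltnn.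
(* The flipped set is [p.1] with its partner, if any. It is closed under the matching and misses
   [p.2] because [p] is not matched. *)
rewrite mul0r addr0 (@gexp_cut_half _ _ _ _ [set w | [|| w == p.1, (w, p.1) \in M | (p.1, w) \in M]]) //.
  move=> q qM; have [_ q12 q1 q2] := MP _ qM; rewrite !finset.in_set.
  have qpair : (q.1, q.2) \in M by rewrite -surjective_pairing.
  have [e1|n1] := eqVneq q.1 p.1; first by rewrite -e1 qpair !orbT.
  have [e2|n2] := eqVneq q.2 p.1; first by rewrite -e2 qpair orbT.
  have N1 : (q.1, p.1) \notin M.
    by apply: contraNN n2 => /MP[_ _ /=]; rewrite q1 => -[->].
  have N2 : (p.1, q.1) \notin M.
    by apply: contraNN n2 => /MP[_ _ /= _]; rewrite q1 => -[->].
  have N3 : (q.2, p.1) \notin M.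
    by apply: contraNN n1 => /MP[_ _ /=]; rewrite q2 => -[->].
  have N4 : (p.1, q.2) \notin M.
    by apply: contraNN n1 => /MP[_ _ /= _]; rewrite q2 => -[->].
  by rewrite (negbTE N1) (negbTE N2) (negbTE N3) (negbTE N4).
rewrite !finset.in_set eqxx /= (eq_sym p.2) (negbTE p12) /=.
have /negbTE -> : (p.2, p.1) \notin M.
  by apply/negP => /MP[_ /= ? _ _]; have := Elt _ pE; rewrite ltnNge ltnW.
by rewrite -surjective_pairing (negbTE pM).
Qed.

(** Sampling on [A] by the exponential mechanism and uniformly off [A] is the global Gibbs measure:
    every assignment on [A] has [2 ^ #|~: A|] extensions, all of the same weight. *)
Lemma gibbsE A b H S : {in H, forall p, (p.1 \in A) && (p.2 \in A)} ->
  expmech A b H (restr A S) * 2^-1 ^+ #|~: A| = weight b H S / partition_fun b H.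
Proof.
move=> HA.
have wr T : val H (restr A T) = val H T.
  apply: eq_card => p; rewrite !inE !ffunE.
  by case: (boolP (p \in H)) => // /HA /andP[-> ->].
have rr T : restr A (restr A T) == restr A T.
  by apply/eqP/ffunP => v; rewrite !ffunE andbA andbb.
rewrite /expmech rr wr -/(weight b H S) -mulrA; congr (_ * _).
rewrite exprVn -invfM; congr (_^-1).
have HA' B : B \subset ~: A -> {in H, forall p, (p.1 \in B) = (p.2 \in B)}.
  move=> /fintype.subsetP BA p /HA /andP[p1 p2].
  have F v : v \in A -> v \in B = false by move=> vA; apply/negP => /BA; rewrite inE vA.
  by rewrite !F.
(* Cuts are grouped by their set of true vertices off [A]; flipping that set maps each group onto
   the assignments that are false off [A]. *)
rewrite /partition_fun [RHS](partition_big (fun T => [set v in ~: A | T v]) (mem (powerset (~: A)))) /=; last first.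
  by move=> T _; rewrite powersetE; apply/fintype.subsetP => v; rewrite inE => /andP[].
rewrite [RHS](eq_bigr (fun=> \sum_(T | restr A T == T) weight b H T)).
  by rewrite sumr_const card_powerset -[RHS]mulr_natl natrX mulrC.
move=> B; rewrite powersetE => BA.
rewrite (reindex_inj (inv_inj (flipK B))) /=.
apply: eq_big => [T|T _]; last by rewrite /weight val_flip //; apply: HA'.
have BAv v : v \in B -> v \notin A by move/(fintype.subsetP BA); rewrite inE.
apply/eqP/eqP => [/finset.setP E|E].
  apply/ffunP => v; have := E v; rewrite !inE !ffunE.
  case: (boolP (v \in A)) => //= vA.
  by case: (v \in B) => //=; case: (T v).
apply/finset.setP => v; rewrite !inE ffunE -[in T v]E ffunE.
by case: (boolP (v \in B)) => [/BAv/negbTE ->|]; case: (v \in A).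
Qed.

End Candidates.

(** Since [t <= expR t], a candidate of value [x] contributes at most [expR (l * y)] to [l] times
    the weighted loss. Only two rivals of [y] contribute, whence [2 / l], which is [8 / eps] at
    [l = eps / 4]. *)
Lemma softmax_ge {R : realType} (l x1 x2 x3 y : R) : 0 < l ->
  [\/ y = x1, y = x2 | y = x3] ->
  y - 2 / l <= (expR (l * x1) * x1 + expR (l * x2) * x2 + expR (l * x3) * x3) /
    (expR (l * x1) + expR (l * x2) + expR (l * x3)).
Proof.
move=> l0 yx.
have W x : expR (l * x) * (l * (y - x)) <= expR (l * y).
  have -> : l * y = l * x + l * (y - x) by ring.
  rewrite expRD ler_pM2l ?expR_gt0 //; have := expR_ge1Dx (l * (y - x)); lra.
have := W x1; have := W x2; have := W x3.
have := expR_gt0 (l * x1); have := expR_gt0 (l * x2); have := expR_gt0 (l * x3).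
set w1 := expR (l * x1); set w2 := expR (l * x2); set w3 := expR (l * x3).
move=> p3 p2 p1 h3 h2 h1.
rewrite ler_pdivlMr ?addr_gt0 // -(ler_pM2l l0).
have -> : l * ((y - 2 / l) * (w1 + w2 + w3)) = l * y * (w1 + w2 + w3) - 2 * (w1 + w2 + w3).
  by field; rewrite gt_eqF.
have -> : l * (w1 * x1 + w2 * x2 + w3 * x3) =
  l * y * (w1 + w2 + w3) - (w1 * (l * (y - x1)) + w2 * (l * (y - x2)) + w3 * (l * (y - x3))) by ring.
by case: yx => E; rewrite E in h1 h2 h3 *; rewrite -/w1 -/w2 -/w3 in h1 h2 h3; rewrite !subrr !mulr0 in h1 h2 h3 *; lra.
Qed.

(** * Random subgraph and mutual choices *)

Section ProductMeasures.
Context {R : realType}.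

(** Law of a random subset with independent inclusions; it describes both [V1] and [E2], the latter
    with probability zero off the available edges. *)
Definition bern (I : finType) (x : I -> R) (A : {set I}) : R :=
  \prod_i (if i \in A then x i else 1 - x i).

Lemma bern_ge0 (I : finType) (x : I -> R) A : (forall i, 0 <= x i <= 1) -> 0 <= bern x A.
Proof.
by move=> x01; apply: prodr_ge0 => i _; have /andP[? ?] := x01 i; case: ifP => _ //; rewrite subr_ge0.
Qed.

Lemma bern_subset (I : finType) (x : I -> R) (T : {set I}) :
  \sum_(A : {set I}) bern x A * (T \subset A)%:R = \prod_(i in T) x i.
Proof.
rewrite [RHS]big_mkcond /=.
transitivity (\prod_i (x i + (if i \in T then 0 else 1 - x i))); last first.
  by apply: eq_bigr => i _; case: ifP => _; rewrite ?addr0 // addrC subrK.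
rewrite bigA_distr; apply: eq_bigr => A _; rewrite /bern.
case: (boolP (T \subset A)) => [/fintype.subsetP TA|/fintype.subsetPn [i iT iA]].
  rewrite mulr1; apply: eq_bigr => i _; case: ifP => // iA; case: ifP => // /TA.
  by rewrite iA.
by rewrite mulr0 (bigD1 i) //= (negbTE iA) iT mul0r.
Qed.

Lemma bern_sum1 (I : finType) (x : I -> R) : \sum_(A : {set I}) bern x A = 1.
Proof.
rewrite -[RHS](_ : \prod_(i in finset.set0) x i = 1); last by rewrite big_set0.
by rewrite -bern_subset; apply: eq_bigr => A _; rewrite finset.sub0set mulr1.
Qed.

Lemma bern_mem (I : finType) (x : I -> R) i :
  \sum_(A : {set I}) bern x A * (i \in A)%:R = x i.
Proof.
rewrite -[RHS](_ : \prod_(k in [set i]%SET) x k = x i); last by rewrite big_set1.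
by rewrite -bern_subset; apply: eq_bigr => A _; rewrite finset.sub1set.
Qed.

Lemma bern_notin (I : finType) (x : I -> R) i :
  \sum_(A : {set I}) bern x A * (i \notin A)%:R = 1 - x i.
Proof.
rewrite -[X in X - _](bern_sum1 x) -(bern_mem x i) -sumrB; apply: eq_bigr => A _.
by case: (_ \in _); rewrite /= ?mulr1 ?mulr0 ?subrr ?subr0.
Qed.

Lemma bern_mem2 (I : finType) (x : I -> R) i j : i != j ->
  \sum_(A : {set I}) bern x A * ((i \in A) && (j \in A))%:R = x i * x j.
Proof.
move=> ij; rewrite -[RHS](_ : \prod_(k in [set i; j]%SET) x k = x i * x j); last first.
  by rewrite big_setU1 ?big_set1 // inE.
by rewrite -bern_subset; apply: eq_bigr => A _; rewrite finset.subUset !finset.sub1set.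
Qed.

Lemma ffun_prod_sum1 (I J : finType) (F : I -> J -> R) : (forall i, \sum_j F i j = 1) ->
  \sum_(f : {ffun I -> J}) \prod_i F i (f i) = 1.
Proof. by move=> F1; rewrite -bigA_distr_bigA big1. Qed.

Lemma ffun_prod_mem2 (I J : finType) (F : I -> J -> R) u v a b : u != v ->
  (forall i, \sum_j F i j = 1) ->
  \sum_(f : {ffun I -> J}) (\prod_i F i (f i)) * ((f u == a) && (f v == b))%:R = F u a * F v b.
Proof.
move=> uv F1.
(* Absorbing the two constraints into the factors at [u] and [v] restores the product form. *)
pose G i j := F i j * ((i == u) ==> (j == a))%:R * ((i == v) ==> (j == b))%:R.
transitivity (\prod_i \sum_j G i j).
  rewrite bigA_distr_bigA; apply: eq_bigr => f _; rewrite /G !big_split /= -mulrA; congr (_ * _).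
  rewrite [X in _ = X * _](bigD1 u) //= [X in _ = _ * X](bigD1 v) //= !eqxx /= !big1 ?mulr1.
  - by case: (f u == a); rewrite ?mul1r ?mul0r.
  - by move=> i /negbTE ->.
  - by move=> i /negbTE ->.
rewrite (bigD1 u) //= (bigD1 v) 1?eq_sym //= mulrA [X in _ * X = _]big1 => [|i /andP[/negbTE iu /negbTE iv]]; last first.
  by rewrite -[RHS](F1 i); apply: eq_bigr => j _; rewrite /G iu iv !mulr1.
rewrite mulr1; congr (_ * _).
  rewrite (bigD1 a) //= big1 => [|j /negbTE ja]; rewrite /G eqxx (negbTE uv) /=.
    by rewrite eqxx !mulr1 addr0.
  by rewrite ja mulr0 mul0r.
rewrite (bigD1 b) //= big1 => [|j /negbTE ja]; rewrite /G eqxx eq_sym (negbTE uv) /=.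
  by rewrite eqxx !mulr1 addr0.
by rewrite ja !mulr0.
Qed.

End ProductMeasures.

(** * Degree sums and the expected size of the matching *)

Section RandomMatching.
Context {R : realType} {n : nat}.
Local Notation edges := {set 'I_n * 'I_n}.
Implicit Types (E : edges) (A : {set 'I_n}) (e : rel 'I_n).

Lemma sum_deg e (phi : 'I_n -> R) : symmetric e -> irreflexive e ->
  \sum_v (deg e v)%:R * phi v = \sum_(p in edge_set e) (phi p.1 + phi p.2).
Proof.
move=> es ei.
transitivity (\sum_(p : 'I_n * 'I_n) (e p.1 p.2)%:R * phi p.1).
  rewrite -(pair_bigA _ (fun u v => (e u v)%:R * phi u)) /=; apply: eq_bigr => v _.
  rewrite -big_distrl /deg -sum1_card natr_sum big_mkcond /=; congr (_ * _).
  by apply: eq_bigr => u _; rewrite inE; case: (e v u).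
rewrite (bigID (fun p : 'I_n * 'I_n => (p.1 < p.2)%N)) big_split /=; congr (_ + _).
  rewrite big_mkcond [RHS]big_mkcond; apply: eq_bigr => p _; rewrite inE.
  by case: ltnP => //= _; case: (e _ _); rewrite ?mul1r ?mul0r.
rewrite (reindex_inj (_ : injective (fun p : 'I_n * 'I_n => (p.2, p.1)))) /=; last by case=> [a b] [c d] [-> ->].
rewrite big_mkcond [RHS]big_mkcond; apply: eq_bigr => -[u v] _; rewrite inE /= es -leqNgt.
by case: ltngtP => //= [_|/val_inj ->]; rewrite ?ei ?mul0r //; case: (e _ _); rewrite ?mul1r ?mul0r.
Qed.

Lemma sum_incident e u : symmetric e -> irreflexive e ->
  \sum_(p in edge_set e) ((p.1 == u)%:R + (p.2 == u)%:R) = (deg e u)%:R :> R.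
Proof.
move=> es ei; rewrite -(@sum_deg e (fun v => (v == u)%:R)) // (bigD1 u) //= eqxx mulr1 big1 ?addr0 //.
by move=> v /negbTE ->; rewrite mulr0.
Qed.

Lemma pE2E (q : R) (Et E2 : edges) :
  pE2 q Et E2 = bern (fun p => if p \in Et then q else 0) E2.
Proof.
rewrite /pE2 /bern; case: (boolP (E2 \subset Et)) => [/fintype.subsetP EE|/fintype.subsetPn [p pE pEt]]; last first.
  by rewrite (bigD1 p) //= pE (negbTE pEt) mul0r.
rewrite (bigID (mem E2)) /=; congr (_ * _).
  by rewrite -prodr_const; apply: eq_big => // p pE; rewrite pE EE.
have -> : (#|Et| - #|E2|)%N = #|Et :\: E2|.
  by rewrite cardsD; congr (_ - #|pred_of_set _|)%N; apply/esym/finset.setIidPr/fintype.subsetP.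
rewrite -prodr_const [RHS]big_mkcond [LHS]big_mkcond; apply: eq_bigr => p _; rewrite !inE.
by case: (p \in E2) => //=; case: (p \in Et); rewrite ?subr0.
Qed.

Definition pfv A E (v : 'I_n) (o : option 'I_n) : R :=
  if v \in A then
    (if #|nbr E v| == 0%N then (o == None)%:R
     else if o is Some u then (u \in nbr E v)%:R / (#|nbr E v|)%:R else 0)
  else (o == None)%:R.

Lemma pfv_sum1 A E v : \sum_o pfv A E v o = 1.
Proof.
rewrite /pfv (bigD1 None) //=.
have SomeE (F : option 'I_n -> R) : \sum_(o | o != None) F o = \sum_u F (Some u).
  rewrite (reindex_omap Some id) => [|[]//]; by apply: eq_bigl => u; rewrite eqxx.
rewrite SomeE /=.
case: ifP => _; last by rewrite big1 ?addr0.
case: ifP => [_|/negbT n0]; first by rewrite big1 ?addr0.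
rewrite add0r -big_distrl /= -[X in X / _](_ : #|nbr E v|%:R = _) ?divff //.
  by rewrite pnatr_eq0.
by rewrite -sum1_card natr_sum big_mkcond; apply: eq_bigr => u _; case: (_ \in _).
Qed.

Lemma pf_ge0 A E f : 0 <= pf A E f :> R.
Proof.
apply: prodr_ge0 => v _; case: ifP => _ //; case: ifP => _ //.
by case: (f v) => // u; rewrite divr_ge0.
Qed.

Lemma pf_sum1 A E : \sum_f pf A E f = 1 :> R.
Proof. exact: (ffun_prod_sum1 (pfv_sum1 A E)). Qed.

Lemma pf_mutual A E u v : u != v -> u \in A -> v \in A -> (u, v) \in E ->
  \sum_f pf A E f * ((f u == Some v) && (f v == Some u))%:R =
  ((#|nbr E u|)%:R * (#|nbr E v|)%:R)^-1 :> R.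
Proof.
move=> uv uA vA uvE; rewrite (ffun_prod_mem2 (Some v) (Some u) uv (pfv_sum1 A E)) /pfv uA vA.
have vu : v \in nbr E u by rewrite inE uvE.
have uv' : u \in nbr E v by rewrite inE uvE orbT.
have -> : #|nbr E u| == 0%N = false by apply/negbTE; rewrite -lt0n; apply/card_gt0P; exists v.
have -> : #|nbr E v| == 0%N = false by apply/negbTE; rewrite -lt0n; apply/card_gt0P; exists u.
by rewrite vu uv' !mul1r invfM.
Qed.

Lemma nbr_le E u : #|nbr E u|%:R <= \sum_(p in E) ((p.1 == u)%:R + (p.2 == u)%:R) :> R.
Proof.
have -> : #|nbr E u|%:R = \sum_w (((u, w) \in E) || ((w, u) \in E))%:R :> R.
  rewrite -sum1_card natr_sum big_mkcond; apply: eq_bigr => w _; rewrite inE.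
  by case: (_ || _).
have S1 : \sum_(p in E) (p.1 == u)%:R = \sum_w ((u, w) \in E)%:R :> R.
  transitivity (\sum_a \sum_b ((a, b) \in E)%:R * (a == u)%:R : R).
    rewrite pair_big big_mkcond /=; apply: eq_bigr => -[a b] _ /=.
    by case: (_ \in E); rewrite ?mul1r ?mul0r.
  rewrite (bigD1 u) //= [X in _ + X]big1 ?addr0 => [|a /negbTE au].
    by apply: eq_bigr => b _; rewrite eqxx mulr1.
  by rewrite big1 // => b _; rewrite au mulr0.
have S2 : \sum_(p in E) (p.2 == u)%:R = \sum_w ((w, u) \in E)%:R :> R.
  transitivity (\sum_a \sum_b ((a, b) \in E)%:R * (b == u)%:R : R).
    rewrite pair_big big_mkcond /=; apply: eq_bigr => -[a b] _ /=.
    by case: (_ \in E); rewrite ?mul1r ?mul0r.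
  apply: eq_bigr => a _; rewrite (bigD1 u) //= eqxx mulr1 big1 ?addr0 // => b /negbTE ->.
  by rewrite mulr0.
rewrite big_split /= S1 S2 -big_split /=; apply: ler_sum => w _.
by case: (_ \in _); case: (_ \in _); rewrite /= ?mulr1n ?mulr0n; lra.
Qed.

Lemma card_EM E f : #|EM E f|%:R =
  \sum_(p in E) ((f p.1 == Some p.2) && (f p.2 == Some p.1))%:R :> R.
Proof.
rewrite -sum1_card natr_sum big_mkcond [RHS]big_mkcond; apply: eq_bigr => p _; rewrite inE.
by case: (p \in E) => //=; case: (_ && _).
Qed.

(* The tangent plane of 1/(xy) at (2,2); it makes the expected number of mutual
   choices linear in the degrees. *)
Lemma invM_ge (x y : R) : 1 <= x -> 1 <= y -> (6 - x - y) / 8 <= (x * y)^-1.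
Proof.
move=> x1 y1; have xy0 : 0 < x * y by rewrite mulr_gt0 //; lra.
rewrite -[(x * y)^-1]div1r ler_pdivlMr //.
(* The expression equals [4 * (8 - (6 - x - y) * (x * y))]. If [x + y >= 6] the tangent plane is
   nonpositive and the bound is immediate. *)
have : 0 <= (x - y) ^+ 2 * (6 - x - y) + (x + y - 4) ^+ 2 * (x + y + 2) \/ 6 <= x + y.
  by have [|lt] := leP 6 (x + y); [right | left; rewrite addr_ge0 // mulr_ge0 ?sqr_ge0 //; lra].
case=> [|le6]; first by nra.
have : (6 - x - y) / 8 * (x * y) <= 0 by apply: mulr_le0_ge0; [lra | exact: ltW].
lra.
Qed.

(** An edge is chosen mutually with probability the inverse product of its endpoint degrees. The
    predicate [P] allows edges to be discarded whose linearised bound would be negative. *)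
Lemma matching_given_E2 A E (P : pred ('I_n * 'I_n)) : {in E, forall p : 'I_n * 'I_n, [&& (p.1 < p.2)%N, p.1 \in A & p.2 \in A]} ->
  \sum_(p in E | P p) (6 - \sum_(r in E) ((r.1 == p.1)%:R + (r.2 == p.1)%:R)
    - \sum_(r in E) ((r.1 == p.2)%:R + (r.2 == p.2)%:R)) / 8 <=
  \sum_f pf A E f * #|EM E f|%:R :> R.
Proof.
move=> EA.
rewrite [leRHS](eq_bigr (fun f => \sum_(p in E) pf A E f *
   ((f p.1 == Some p.2) && (f p.2 == Some p.1))%:R)) => [|f _]; last first.
  by rewrite card_EM big_distrr.
rewrite exchange_big /= [leRHS](bigID P) /= -[leLHS]addr0; apply: lerD; last first.
  by apply: sumr_ge0 => p _; apply: sumr_ge0 => f _; rewrite mulr_ge0 ?pf_ge0.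
apply: ler_sum => p /andP[pE _]; have /and3P[p12 p1 p2] := EA p pE.
rewrite pf_mutual -?surjective_pairing -?val_eqE /= ?ltn_eqF //.
have c1 : 1 <= #|nbr E p.1|%:R :> R.
  by rewrite ler1n; apply/card_gt0P; exists p.2; rewrite inE -surjective_pairing pE.
have c2 : 1 <= #|nbr E p.2|%:R :> R.
  by rewrite ler1n; apply/card_gt0P; exists p.1; rewrite inE -surjective_pairing pE orbT.
apply: le_trans (invM_ge c1 c2).
have := nbr_le E p.1; have := nbr_le E p.2; lra.
Qed.

(** After linearisation only inclusion probabilities of one or two edges matter. An edge [p] meets
    both of its own endpoints, which turns 6 into 4; every other edge there survives together with
    [p] with probability [q * q], and the degrees in the whole graph bound their number. *)
Lemma expected_matching e A (q : R) (P : pred ('I_n * 'I_n)) : symmetric e -> irreflexive e -> 0 <= q <= 1 ->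
  \sum_(p in induced (edge_set e) A | P p) q * (4 - q * ((deg e p.1)%:R + (deg e p.2)%:R)) / 8 <=
  \sum_E2 pE2 q (induced (edge_set e) A) E2 * \sum_f pf A E2 f * #|EM E2 f|%:R.
Proof.
move=> es ei /andP[q0 q1]; set Et := induced _ _.
have EtP p : p \in Et -> [/\ p \in edge_set e, (p.1 < p.2)%N, p.1 \in A & p.2 \in A].
  by rewrite inE => /and3P[pE -> ->]; split=> //; move: pE; rewrite inE => /andP[].
pose x (p : 'I_n * 'I_n) := if p \in Et then q else 0.
have x01 p : 0 <= x p <= 1 by rewrite /x; case: ifP; rewrite ?q0 // lexx ler01.
pose t (u : 'I_n) (p : 'I_n * 'I_n) : R := (p.1 == u)%:R + (p.2 == u)%:R.
pose g (E2 : edges) : R := \sum_(p in Et | P p) ((p \in E2)%:R * 6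
    - \sum_(r in Et) ((p \in E2) && (r \in E2))%:R * (t p.1 r + t p.2 r)) / 8.
apply: (@le_trans _ _ (\sum_E2 pE2 q Et E2 * g E2)); last first.
  apply: ler_sum => E2 _; rewrite /pE2.
  case: (boolP (E2 \subset Et)) => [/fintype.subsetP EE|_]; last by rewrite !mul0r.
  apply: ler_wpM2l; first by rewrite mulr_ge0 ?exprn_ge0 // subr_ge0.
  apply: le_trans (matching_given_E2 (A := A) P _); last first.
    by move=> p /EE /EtP[_ -> -> ->].
  rewrite /g (bigID (mem E2)) /= [X in _ + X]big1 ?addr0 => [|p /andP[_ /negbTE pE2]]; last first.
    by rewrite pE2 /= mul0r big1 ?subr0 ?mul0r // => r _; rewrite mul0r.
  rewrite le_eqVlt; apply/orP; left; apply/eqP; apply: eq_big => [p|p /andP[_ pE]].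
    by case: (boolP (p \in E2)) => [/EE ->|]; rewrite ?andbF ?andbT.
  rewrite pE mul1r; congr (_ / _); rewrite -[RHS]addrA -opprD -big_split /=; congr (_ - _).
  rewrite big_mkcond [RHS]big_mkcond; apply: eq_bigr => r _ /=.
  by case: (boolP (r \in E2)) => [/EE ->|]; rewrite ?mul1r ?mul0r //; case: ifP.
have Q1 p : p \in Et -> \sum_E2 pE2 q Et E2 * (p \in E2)%:R = q.
  move=> pE; rewrite (eq_bigr (fun E2 => bern x E2 * (p \in E2)%:R)) => [|E2 _]; last by rewrite pE2E.
  by rewrite bern_mem /x pE.
have Q2 p r : p \in Et -> r \in Et -> p != r ->
    \sum_E2 pE2 q Et E2 * ((p \in E2) && (r \in E2))%:R = q * q.
  move=> pE rE pr; rewrite (eq_bigr (fun E2 => bern x E2 * ((p \in E2) && (r \in E2))%:R)) => [|E2 _].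
    by rewrite bern_mem2 // /x pE rE.
  by rewrite pE2E.
have -> : \sum_E2 pE2 q Et E2 * g E2 = \sum_(p in Et | P p) (q * 6 - \sum_(r in Et)
    (\sum_E2 pE2 q Et E2 * ((p \in E2) && (r \in E2))%:R) * (t p.1 r + t p.2 r)) / 8.
  under eq_bigr => E2 _ do rewrite /g big_distrr /=.
  rewrite exchange_big /=; apply: eq_bigr => p /andP[pE _]; rewrite -[X in X * 6 - _](Q1 p pE).
  under eq_bigr => E2 _ do rewrite mulrA mulrBr mulrA.
  rewrite -big_distrl /= sumrB -big_distrl /=; congr ((_ - _) / _).
  under eq_bigr => E2 _ do rewrite big_distrr /=.
  rewrite exchange_big /=; apply: eq_bigr => r _; rewrite big_distrl /=.
  by apply: eq_bigr => E2 _; rewrite mulrA.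
apply: ler_sum => p /andP[pE _]; rewrite ler_pM2r ?invr_gt0 //.
have [pe p12 _ _] := EtP p pE.
have t0 u r : 0 <= t u r by rewrite addr_ge0.
have tp : t p.1 p + t p.2 p = 2.
  rewrite /t !eqxx -!val_eqE /= (ltn_eqF p12) (gtn_eqF p12) /= mulr1n mulr0n; lra.
rewrite (bigD1 p) //=.
have -> : \sum_E2 pE2 q Et E2 * ((p \in E2) && (p \in E2))%:R = q.
  by rewrite -{2}(Q1 p pE); apply: eq_bigr => E2 _; rewrite andbb.
rewrite tp.
have : \sum_(r in Et | r != p) (\sum_E2 pE2 q Et E2 * ((p \in E2) && (r \in E2))%:R) *
     (t p.1 r + t p.2 r) <= q * q * ((deg e p.1)%:R + (deg e p.2)%:R).
  rewrite -(@sum_incident e p.1) // -(@sum_incident e p.2) // -big_split big_distrr /=.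
  rewrite (eq_bigr (fun r => q * q * (t p.1 r + t p.2 r))) => [|r /andP[rE rp]]; last first.
    by rewrite Q2 // eq_sym.
  rewrite [leRHS](bigID (fun r => (r \in Et) && (r != p))) /= -[leLHS]addr0; apply: lerD.
    rewrite le_eqVlt; apply/orP; left; apply/eqP; apply: eq_bigl => r.
    by case: (boolP (r \in Et)) => [/EtP[-> //]|]; rewrite ?andbF.
  by apply: sumr_ge0 => r _; rewrite !mulr_ge0 ?addr_ge0.
lra.
Qed.

End RandomMatching.

(** * Laplace tails *)

Section Laplace.
Import numFieldNormedType.Exports.
Context {R : realType}.
Local Notation mu := (@lebesgue_measure R).

Lemma derive_expRM (k m x : R) :
  is_derive x 1 (fun y : R => k * expR (m * y)) (k * (m * expR (m * x))).
Proof.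
have H : is_derive x (1 : R) (fun y : R => m * y) m.
  by apply: is_derive_eq; rewrite /GRing.scale /= mulr1.
have H2 : is_derive x (1 : R) (expR \o (fun y : R => m * y)) (expR (m * x) * m).
  exact: is_derive1_comp.
have -> : (fun y : R => k * expR (m * y)) = k \*: (expR \o (fun y : R => m * y)) by [].
by apply: is_derive_eq; rewrite /GRing.scale /= [_ * m]mulrC.
Qed.

Lemma continuous_expRM (k m : R) : continuous (fun y : R => k * expR (m * y)).
Proof.
move=> x; apply: differentiable_continuous; apply/derivable1_diffP.
by have [] := derive_expRM k m x.
Qed.

Variable b : R.
Hypothesis b_gt0 : 0 < b.

Lemma measurable_lap_pdf (D : set R) : measurable_fun D (lap_pdf b).
Proof.
apply: measurable_funTS; apply: measurable_funM => //.
apply: measurableT_comp => //; apply: measurable_funM => //.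
by apply: measurableT_comp => //; exact: normr_measurable.
Qed.

Lemma lap_pdf_ge0 x : 0 <= lap_pdf b x.
Proof. by rewrite divr_ge0 ?expR_ge0 // mulr_ge0 // ltW. Qed.

Lemma lap_pdf_pos x : 0 <= x -> lap_pdf b x = 2^-1 * (b^-1 * expR (- b^-1 * x)).
Proof.
move=> x0; rewrite /lap_pdf ger0_norm // invfM mulrC mulrA.
by congr (_ * expR _); rewrite !mulNr mulrC.
Qed.

Lemma lap_pdf_neg x : x <= 0 -> lap_pdf b x = 2^-1 * (b^-1 * expR (b^-1 * x)).
Proof.
move=> x0; rewrite /lap_pdf ler0_norm // opprK invfM mulrC mulrA.
by congr (_ * expR _); rewrite mulrC.
Qed.

Lemma int_lap_pos t : 0 <= t ->
  (\int[mu]_(x in `]t, +oo[) (lap_pdf b x)%:E = (2^-1 * expR (- t / b))%:E)%E.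
Proof.
move=> t0; rewrite integral_itv_obnd_cbnd; last first.
  by apply/measurable_EFinP; exact: measurable_lap_pdf.
pose F x : R := - 2^-1 * expR (- b^-1 * x).
have dF x : is_derive x (1 : R) F (2^-1 * (b^-1 * expR (- b^-1 * x))).
  by have := derive_expRM (- 2^-1) (- b^-1) x; rewrite !mulNr mulrN opprK.
transitivity (\int[mu]_(x in `[t, +oo[) (2^-1 * (b^-1 * expR (- b^-1 * x)))%:E)%E.
  by apply: eq_integral => x; rewrite inE /= in_itv /= andbT => tx; rewrite lap_pdf_pos // (le_trans t0).
rewrite (@ge0_continuous_FTC2y _ _ F t 0).
- by rewrite /F sub0e mulNr EFinN oppeK mulNr [_^-1 * t]mulrC -mulNr.
- by move=> x _; rewrite !mulr_ge0 ?expR_ge0 ?invr_ge0 // ltW.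
- apply: continuous_subspaceT => x.
  rewrite (_ : (fun _ => _) = (fun y => (2^-1 * b^-1) * expR (- b^-1 * y))); last first.
    by apply/funext => y; rewrite mulrA.
  exact: continuous_expRM.
- rewrite -[X in (_ --> X)%classic](mulr0 (- 2^-1)); apply: cvgM; first exact: cvg_cst.
  rewrite (_ : (fun x => expR (- b^-1 * x)) = (fun z => expR (- z)) \o (fun z => b^-1 * z)); last first.
    by apply/funext => x; rewrite /= mulNr.
  apply: (@cvg_comp _ _ _ _ _ _ (pinfty_nbhs R)); last exact: cvgr_expR.
  by apply: gt0_cvgMry; rewrite ?invr_gt0.
- by move=> x _; have [] := dF x.
- apply: cvg_at_right_filter; exact: continuous_expRM.
- by move=> x _; rewrite derive1E; have [_ ->] := dF x.
Qed.

Lemma int_lap_neg t : t < 0 ->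
  (\int[mu]_(x in `]t, 0%R]) (lap_pdf b x)%:E = (2^-1 - 2^-1 * expR (t / b))%:E)%E.
Proof.
move=> t0; rewrite integral_itv_obnd_cbnd; last first.
  by apply/measurable_EFinP; exact: measurable_lap_pdf.
pose F x : R := 2^-1 * expR (b^-1 * x).
have dF x : is_derive x (1 : R) F (2^-1 * (b^-1 * expR (b^-1 * x))) := derive_expRM 2^-1 b^-1 x.
transitivity (\int[mu]_(x in `[t, 0%R]) (2^-1 * (b^-1 * expR (b^-1 * x)))%:E)%E.
  by apply: eq_integral => x; rewrite inE /= in_itv /= => /andP[_ x0]; rewrite lap_pdf_neg.
rewrite (@continuous_FTC2 _ _ F) //.
- by rewrite /F mulr0 expR0 mulr1 -EFinB [_^-1 * t]mulrC.
- apply: continuous_subspaceT => x.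
  rewrite (_ : (fun _ => _) = (fun y => (2^-1 * b^-1) * expR (b^-1 * y))); last first.
    by apply/funext => y; rewrite mulrA.
  exact: continuous_expRM.
- split; first by move=> x _; have [] := dF x.
    apply: cvg_at_right_filter; exact: continuous_expRM.
  apply: cvg_at_left_filter; exact: continuous_expRM.
- by move=> x _; rewrite derive1E; have [_ ->] := dF x.
Qed.

Lemma lap_tail_pos t : 0 <= t -> lap_tail b t = 2^-1 * expR (- t / b).
Proof. by move=> t0; rewrite /lap_tail /Rintegral int_lap_pos. Qed.

Lemma lap_tail_neg t : t < 0 -> lap_tail b t = 1 - 2^-1 * expR (t / b).
Proof.
move=> t0; rewrite /lap_tail /Rintegral (@itv_bndbnd_setU _ _ _ (BRight 0)) ?bnd_simp // ?ltW //.
rewrite ge0_integral_setU //=; last 3 first.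
- by apply/measurable_EFinP; exact: measurable_lap_pdf.
- by move=> x _; rewrite lee_fin lap_pdf_ge0.
- apply/disj_setPS => x /=; rewrite !in_itv /= andbT => -[/andP[_ x0] x1].
  by move: x0; rewrite leNgt x1.
rewrite int_lap_neg // int_lap_pos // oppr0 mul0r expR0 /=; lra.
Qed.

Lemma lap_tail_bounds t : 0 <= lap_tail b t <= 1.
Proof.
have [t0|t0] := leP 0 t.
  rewrite lap_tail_pos // mulr_ge0 ?expR_ge0 //=.
  have : expR (- t / b) <= 1 by rewrite -expR0 ler_expR mulNr oppr_le0 divr_ge0 // ltW.
  lra.
have : expR (t / b) <= 1.
  by rewrite -expR0 ler_expR mulr_le0_ge0 ?invr_ge0 // ltW.
have := expR_ge0 (t / b).
rewrite lap_tail_neg //; lra.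
Qed.

Lemma lap_tail_le t : 0 <= t -> lap_tail b t <= expR (- t / b).
Proof. by move=> t0; rewrite lap_tail_pos //; have := expR_ge0 (- t / b); lra. Qed.

Lemma lap_head_le t : t < 0 -> 1 - lap_tail b t <= expR (t / b).
Proof. by move=> t0; rewrite lap_tail_neg //; have := expR_ge0 (t / b); lra. Qed.

End Laplace.

(** * Conditional expectation given the first step *)

Section Algorithm.
Context {R : realType} {n : nat}.
Local Notation cut := {ffun 'I_n -> bool}.
Local Notation edges := {set 'I_n * 'I_n}.
Implicit Types (S T : cut) (A : {set 'I_n}) (E H : edges) (e : rel 'I_n).

Lemma gexp_exchange b H b' H' (F : cut -> cut -> R) :
  gexp b H (fun S => gexp b' H' (F S)) = gexp b' H' (fun T => gexp b H (F^~ T)).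
Proof.
rewrite /gexp; set Z := partition_fun b H; set Z' := partition_fun b' H'.
transitivity (\sum_S \sum_T weight b H S * weight b' H' T * F S T / Z' / Z).
  rewrite big_distrl; apply: eq_bigr => S _ /=; rewrite mulrA mulr_sumr !mulr_suml.
  by apply: eq_bigr => T _; rewrite mulrA.
rewrite exchange_big big_distrl; apply: eq_bigr => T _ /=; rewrite mulrA mulr_sumr !mulr_suml.
by apply: eq_bigr => S _; ring.
Qed.

Lemma edge_lt e p : p \in edge_set e -> (p.1 < p.2)%N.
Proof. by rewrite inE => /andP[]. Qed.

Lemma induced_mem E A : {in induced E A, forall p, (p.1 \in A) && (p.2 \in A)}.
Proof. by move=> p; rewrite inE => /andP[]. Qed.

Lemma induced_sub E A : induced E A \subset E.
Proof. by apply/fintype.subsetP => p; rewrite inE => /andP[]. Qed.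

(** Expected output value given [V1], [E2] and [f]; the averages are nested because the two sampled
    cuts are then independent. *)
Definition final_mean e (eps : R) V1 (E2 : edges) (f : {ffun 'I_n -> option 'I_n}) : R :=
  gexp (eps / 12) (induced (edge_set e) V1) (fun S1 =>
  gexp (5 / 2 / 4) (EM E2 f) (fun S2 => final_val e eps S1 S2 [ffun v => v \in V1])).

Lemma alg_expectE e (eps alpha : R) :
  alg_expect e eps alpha =
  \sum_V1 pV1 e eps alpha V1 *
  \sum_E2 pE2 (eps `^ (1 + alpha) / 70) (induced (edge_set e) (~: V1)) E2 *
  \sum_f pf (~: V1) E2 f * final_mean e eps V1 E2 f.
Proof.
apply: eq_bigr => V1 _; congr (_ * _); apply: eq_bigr => E2 _.
have [EE|EE] := boolP (E2 \subset induced (edge_set e) (~: V1)); last first.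
  by rewrite /pE2 (negbTE EE) !mul0r.
congr (_ * _); apply: eq_bigr => f _; congr (_ * _).
rewrite /final_mean {1}/gexp big_distrl; apply: eq_bigr => S1 _ /=.
rewrite gibbsE; last exact: induced_mem.
rewrite mulrAC; congr (_ * _ / _).
rewrite /gexp big_distrl; apply: eq_bigr => S2 _ /=.
rewrite -[#|V1|](_ : #|~: ~: V1| = _); last by rewrite finset.setCK.
rewrite gibbsE; first by rewrite mulrAC.
move=> p; rewrite inE => /andP[/(fintype.subsetP EE) pE _]; exact: induced_mem pE.
Qed.

Lemma final_val_ge e (eps : R) S1 S2 S3 S : 0 < eps -> [\/ S = S1, S = S2 | S = S3] ->
  (val (edge_set e) S)%:R - 8 / eps <= final_val e eps S1 S2 S3.
Proof.
move=> eps0 SS; have -> : 8 / eps = 2 / (eps / 4) by field; rewrite gt_eqF.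
rewrite /final_val; apply: softmax_ge; first by rewrite divr_gt0.
by case: SS => ->; [constructor 1 | constructor 2 | constructor 3].
Qed.

Section Conditional.
Variables (e : rel 'I_n) (eps : R) (V1 : {set 'I_n}).
Hypothesis eps0 : 0 < eps.
Let E := edge_set e.
Let m : R := #|E|%:R.
Let b1_ge0 : 0 <= eps / 12. Proof. by rewrite divr_ge0 // ltW. Qed.

Lemma final_mean_ge_S1 E2 f :
  gexp (eps / 12) (induced E V1) (fun S => (val E S)%:R) - 8 / eps <= final_mean e eps V1 E2 f.
Proof.
rewrite -[X in _ - X](gexp_cst (eps / 12) (induced E V1)) -mulN1r -gexpZ -gexpD.
apply: ler_gexp => S; rewrite -[leLHS](gexp_cst (5 / 2 / 4) (EM E2 f)).
by apply: ler_gexp => T; rewrite mulN1r; apply: final_val_ge => //; constructor 1.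
Qed.

Lemma final_mean_ge_S3 E2 f :
  (val E [ffun v => v \in V1])%:R - 8 / eps <= final_mean e eps V1 E2 f.
Proof.
rewrite -[leLHS](gexp_cst (eps / 12) (induced E V1)).
apply: ler_gexp => S; rewrite -[leLHS](gexp_cst (5 / 2 / 4) (EM E2 f)).
by apply: ler_gexp => T; apply: final_val_ge => //; constructor 3.
Qed.

Lemma gexp_S1_ge_half :
  m / 2 <= gexp (eps / 12) (induced E V1) (fun S => (val E S)%:R).
Proof.
rewrite (@gexp_val_out _ _ _ _ V1); [|exact: induced_mem|exact: edge_lt].
have := @gexp_val_ge_half R n (eps / 12) (induced E V1) b1_ge0 _.
have H12 : {in induced E V1, forall p, p.1 != p.2}.
  by move=> p /(fintype.subsetP (induced_sub _ _))/edge_lt; rewrite -val_eqE /= => /ltn_eqF ->.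
by move=> /(_ H12); rewrite -/m; lra.
Qed.

Hypothesis es : symmetric e.

Lemma edge_deg_gt0 p : p \in E -> (0 < deg e p.1)%N && (0 < deg e p.2)%N.
Proof.
rewrite inE => /andP[_ ep]; apply/andP; split; apply/card_gt0P.
  by exists p.2; rewrite inE.
by exists p.1; rewrite inE es.
Qed.

(** The entropy term counts only non-isolated vertices of [V1], because [n] is not controlled by the
    number of edges. *)
Lemma gexp_S1_ge_cut T :
  (m - #|induced E V1|%:R) / 2 + (val (induced E V1) T)%:R
    - #|[set v in V1 | (0 < deg e v)%N]|%:R * (12 / eps) <=
  gexp (eps / 12) (induced E V1) (fun S => (val E S)%:R).
Proof.
rewrite (@gexp_val_out _ _ _ _ V1); [|exact: induced_mem|exact: edge_lt].
have b0 : 0 < eps / 12 by rewrite divr_gt0.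
have := @gexp_val_ge R n (eps / 12) (induced E V1) [set v in V1 | (0 < deg e v)%N] T b0 _.
have HU : {in induced E V1, forall p,
   (p.1 \in [set v in V1 | (0 < deg e v)%N]) && (p.2 \in [set v in V1 | (0 < deg e v)%N])}.
  move=> p pH; have /andP[p1 p2] := induced_mem pH.
  have /andP[d1 d2] := edge_deg_gt0 (fintype.subsetP (induced_sub _ _) _ pH).
  by rewrite !inE p1 p2 d1 d2.
by move=> /(_ HU); rewrite invf_div -/m; lra.
Qed.

(** The output competes with the better of two cuts, whose value is half of the sum plus the
    absolute difference. This halves both the matching gain [1 / 10] and the deviation constant
    [7 / 400]. *)
Lemma final_mean_ge_S2 E2 f : E2 \subset E ->
  m / 2 + #|EM E2 f|%:R / 20 + 7 / 800 * Num.sqrt #|induced E (~: V1)|%:R - 8 / eps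
    <= final_mean e eps V1 E2 f.
Proof.
move=> E2E; pose v S : R := (val E S)%:R.
pose g1 := @gexp R n (eps / 12) (induced E V1); pose g2 := @gexp R n (5 / 2 / 4) (EM E2 f).
have max_avg S T : 2^-1 * (v S + v T + `|v S - v T|) - 8 / eps <=
    final_val e eps S T [ffun w => w \in V1].
  have [le|lt] := leP (v T) (v S).
    have := @final_val_ge e eps S T [ffun w => w \in V1] S eps0 (Or31 _ _ erefl).
    by rewrite ger0_norm ?subr_ge0 // -/E -/(v S); lra.
  have := @final_val_ge e eps S T [ffun w => w \in V1] T eps0 (Or32 _ _ erefl).
  by rewrite ltr0_norm ?subr_lt0 // -/E -/(v T); lra.
have low : g1 (fun S => g2 (fun T => 2^-1 * (v S + v T + `|v S - v T|) - 8 / eps)) <=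
    final_mean e eps V1 E2 f.
  by apply: ler_gexp => S; apply: ler_gexp => T; exact: max_avg.
apply: le_trans low.
have -> : g1 (fun S => g2 (fun T => 2^-1 * (v S + v T + `|v S - v T|) - 8 / eps)) =
    2^-1 * (g1 v + g2 v + g1 (fun S => g2 (fun T => `|v S - v T|))) - 8 / eps.
  rewrite [LHS](@eq_gexp _ _ _ _ _ (fun S => 2^-1 * (v S + g2 v + g2 (fun T => `|v S - v T|)) - 8 / eps)).
    by rewrite /g1 gexpD gexpZ !gexpD !gexp_cst.
  by move=> S; rewrite /g2 gexpD gexpZ !gexpD !gexp_cst.
(* With the second cut fixed, its value is a constant centre for the deviation of the first. *)
rewrite /g1 /g2 gexp_exchange.
have := gexp_S1_ge_half; rewrite -/(g1 v) => h1.
have := @gexp_matching R n E E2 f (@edge_lt e) E2E; rewrite -/(g2 v) -/m => h2.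
have h3 : 7 / 400 * Num.sqrt #|induced E (~: V1)|%:R <= g2 (fun T => g1 (fun S => `|v S - v T|)).
  rewrite -[leLHS](gexp_cst (5 / 2 / 4) (EM E2 f)); apply: ler_gexp => T.
  by apply: gexp_dev; [exact: induced_mem | exact: edge_lt].
rewrite -/(g1 v) -/(g2 v) -/(g2 _); move: h1 h2 h3; rewrite /g1 /g2; lra.
Qed.

End Conditional.

(* The expectation over steps (3)-(6) of the algorithm, given [V1]. *)
Definition cond_mean e (eps alpha : R) V1 : R :=
  \sum_E2 pE2 (eps `^ (1 + alpha) / 70) (induced (edge_set e) (~: V1)) E2 *
  \sum_f pf (~: V1) E2 f * final_mean e eps V1 E2 f.

Lemma pE2_ge0 (q : R) H E2 : 0 <= q <= 1 -> 0 <= pE2 q H E2.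
Proof.
move=> /andP[q0 q1]; rewrite /pE2; case: ifP => // _.
by rewrite mulr_ge0 ?exprn_ge0 // subr_ge0.
Qed.

Lemma pE2_sum1 (q : R) H : \sum_E2 pE2 q H E2 = 1.
Proof.
by rewrite (eq_bigr (bern (fun p => if p \in H then q else 0))) ?bern_sum1 // => E2 _; rewrite pE2E.
Qed.

Lemma cond_mean_ge e (eps alpha : R) V1 (lb : edges -> {ffun 'I_n -> option 'I_n} -> R) :
  let q := eps `^ (1 + alpha) / 70 in let Et := induced (edge_set e) (~: V1) in
  0 <= q <= 1 -> (forall E2 f, E2 \subset Et -> lb E2 f <= final_mean e eps V1 E2 f) ->
  \sum_E2 pE2 q Et E2 * \sum_f pf (~: V1) E2 f * lb E2 f <= cond_mean e eps alpha V1.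
Proof.
move=> q Et q01 H; apply: ler_sum => E2 _.
have [EE|EE] := boolP (E2 \subset Et); last by rewrite /pE2 (negbTE EE) !mul0r.
apply: ler_wpM2l; first exact: pE2_ge0.
by apply: ler_sum => f _; apply: ler_wpM2l; [exact: pf_ge0 | exact: H].
Qed.

Lemma cond_mean_ge_cst e (eps alpha : R) V1 a : 0 <= eps `^ (1 + alpha) / 70 <= 1 ->
  (forall E2 f, E2 \subset edge_set e -> a <= final_mean e eps V1 E2 f) ->
  a <= cond_mean e eps alpha V1.
Proof.
move=> q01 H; apply: le_trans (cond_mean_ge (lb := fun _ _ => a) q01 _).
  under eq_bigr => E2 _ do rewrite -mulr_suml pf_sum1 mul1r.
  by rewrite -mulr_suml pE2_sum1 mul1r.
by move=> E2 f EE; apply: H; apply: fintype.subset_trans EE (induced_sub _ _).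
Qed.

Lemma cond_mean_ge_matching e (eps alpha : R) V1 (P : pred ('I_n * 'I_n)) :
  symmetric e -> irreflexive e -> 0 < eps ->
  let q := eps `^ (1 + alpha) / 70 in let Et := induced (edge_set e) (~: V1) in
  0 <= q <= 1 ->
  #|edge_set e|%:R / 2 +
  (\sum_(p in Et | P p) q * (4 - q * ((deg e p.1)%:R + (deg e p.2)%:R)) / 8) / 20
  + 7 / 800 * Num.sqrt #|Et|%:R - 8 / eps <= cond_mean e eps alpha V1.
Proof.
move=> es ei eps0 q Et q01.
pose a : R := #|edge_set e|%:R / 2 + 7 / 800 * Num.sqrt #|Et|%:R - 8 / eps.
pose lb (E2 : edges) f : R := a + 20^-1 * #|EM E2 f|%:R.
apply: le_trans (cond_mean_ge (lb := lb) q01 _); last first.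
  move=> E2 f EE.
  have := @final_mean_ge_S2 e eps V1 eps0 E2 f (fintype.subset_trans EE (induced_sub _ _)).
  rewrite /lb /a -/Et; lra.
have -> : \sum_E2 pE2 q Et E2 * \sum_f pf (~: V1) E2 f * lb E2 f =
    a + 20^-1 * \sum_E2 pE2 q Et E2 * \sum_f pf (~: V1) E2 f * #|EM E2 f|%:R.
  rewrite mulr_sumr -[a in RHS]mul1r -[X in X * a + _](pE2_sum1 q Et) mulr_suml -big_split /=.
  apply: eq_bigr => E2 _; rewrite mulrCA -mulrDr; congr (_ * _).
  rewrite mulr_sumr -[a in RHS]mul1r -[X in X * a + _](pf_sum1 (~: V1) E2) mulr_suml -big_split /=.
  apply: eq_bigr => f _; by rewrite /lb mulrDr [in RHS]mulrCA.
have := @expected_matching R n e (~: V1) q P es ei q01.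
by rewrite -/Et /a; lra.
Qed.

End Algorithm.

(** * The gain over half of the edges for a fixed [V1] *)

Section Gain.
Context {R : realType} {n : nat}.
Implicit Types (S : {ffun 'I_n -> bool}) (A : {set 'I_n}) (E : {set 'I_n * 'I_n}) (e : rel 'I_n).

Lemma card_sum (I : finType) (A : {set I}) : #|A|%:R = \sum_i (i \in A)%:R :> R.
Proof. by rewrite -sum1_card natr_sum big_mkcond; apply: eq_bigr => i _; case: (i \in A). Qed.

Lemma card_split E A :
  #|E|%:R = #|induced E A|%:R + (val E [ffun v => v \in A])%:R + #|induced E (~: A)|%:R :> R.
Proof.
rewrite !card_sum -!big_split; apply: eq_bigr => p _ /=; rewrite !inE !ffunE.
by case: (p \in E); case: (p.1 \in A); case: (p.2 \in A); rewrite /= ?mulr1n ?mulr0n; lra.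
Qed.

Lemma val_induced_ge E A S :
  (val E S)%:R - (#|E|%:R - #|induced E A|%:R) <= (val (induced E A) S)%:R :> R.
Proof.
rewrite -subr_ge0 !card_sum -!sumrB; apply: sumr_ge0 => p _; rewrite !inE.
by case: (p \in E); case: (S p.1 != S p.2); case: (p.1 \in A); case: (p.2 \in A); rewrite /= ?mulr1n ?mulr0n; lra.
Qed.

Definition low_deg e (t : R) : pred ('I_n * 'I_n) :=
  fun p => ((deg e p.1)%:R <= t) && ((deg e p.2)%:R <= t).

(** An edge outside [V1] that is not of low degree is charged to an endpoint of degree above [t]
    that [V1] missed. *)
Lemma card_low_degree e V1 (t : R) : symmetric e -> irreflexive e ->
  #|induced (edge_set e) (~: V1)|%:R
    - \sum_v (deg e v)%:R * ((v \notin V1) && (t < (deg e v)%:R))%:R <=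
  #|[set p in induced (edge_set e) (~: V1) | low_deg e t p]|%:R :> R.
Proof.
move=> es ei; rewrite (@sum_deg R n e _ es ei) [X in _ - X]big_mkcond lerBlDr.
rewrite !card_sum -big_split; apply: ler_sum => p _ /=; rewrite /low_deg !inE.
case: ((p.1 < p.2)%N && e p.1 p.2) => //=; last by rewrite mulr0n addr0.
case: (p.1 \in V1); case: (p.2 \in V1); rewrite /= ?mulr0n ?addr0 ?add0r //.
by case: leP => _; case: leP => _; rewrite /= ?mulr1n ?mulr0n; lra.
Qed.

Lemma sum_mutual_ge e V1 (d : R) : symmetric e -> irreflexive e -> 0 < d ->
  d / 50 / 5 * #|[set p in induced (edge_set e) (~: V1) | low_deg e (48 / d) p]|%:R <=
  \sum_(p in induced (edge_set e) (~: V1) | low_deg e (48 / d) p)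
    d / 70 * (4 - d / 70 * ((deg e p.1)%:R + (deg e p.2)%:R)) / 8.
Proof.
move=> es ei d0; rewrite -sum1_card natr_sum mulr_sumr.
rewrite (eq_bigl (fun p => (p \in induced (edge_set e) (~: V1)) && low_deg e (48 / d) p)) => [|p]; last by rewrite inE.
apply: ler_sum => p /andP[_ /andP[p1 p2]]; rewrite mulr1.
have : d * (deg e p.1)%:R <= 48 by rewrite mulrC -ler_pdivlMr.
have : d * (deg e p.2)%:R <= 48 by rewrite mulrC -ler_pdivlMr.
set x := (deg e p.1)%:R; set y := (deg e p.2)%:R => dy dx.
have -> : d / 70 * (4 - d / 70 * (x + y)) / 8 = d * (4 / 70 / 8 - (d * x + d * y) / 70 / 70 / 8) by field.
(* Numerically, [4 / 560 - 96 / 39200] exceeds [1 / 250]. *)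
rewrite -mulrA ler_pM2l //; lra.
Qed.

(* The three cases: many edges inside [V1] ([S_1] wins), many cross edges
   ([S_3] wins), or many edges outside [V1] ([S_2], together with the
   fluctuations of [S_1], wins); the third is the only one where the gain is
   small. *)
Lemma gain_cases (m m11 m12 m22 r r22 d K bad good vS g8 eps G X : R) :
  1 <= m -> 0 < eps -> 0 < d <= 1 -> m = m11 + m12 + m22 ->
  0 <= m11 -> 0 <= m12 -> 0 <= m22 -> 0 <= K -> 0 <= bad ->
  0 <= r -> r ^+ 2 = m -> 0 <= r22 -> r22 ^+ 2 = m22 ->
  99 / 100 * m <= vS + (m - m11) ->
  m22 - bad <= good ->
  G = r / 30 / 30 + d * m / 60 / 60 / 80 ->
  m / 2 - g8 <= X ->
  (m - m11) / 2 + vS - K * (12 / eps) - g8 <= X ->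
  m12 - g8 <= X ->
  m / 2 + d / 50 / 5 * good / 20 + r22 / 12 / 10 - g8 <= X ->
  m / 2 - g8 + G * (1 - 60 / (eps * m) * K - 100 / m * bad) <= X.
Proof.
move=> m1 e0 /andP[d0 d1] mE h11 h12 h22 K0 bad0 r0 r2 r220 r222 hS hgood GE X0 X1 X2 X3.
have m0 : 0 < m by lra.
have G0 : 0 <= G by rewrite GE addr_ge0 // !divr_ge0 // mulr_ge0 // ltW.
have r1 : 1 <= r by rewrite -ler_sqr ?nnegrE // r2 expr1n.
have rm : r <= m by rewrite -r2 expr2 ler_peMr.
have Gm : G <= m / 80.
  have : d * m <= m by rewrite -[leRHS]mul1r ler_pM2r.
  rewrite GE; lra.
(* If the factor multiplying [G] is nonpositive, the baseline [m / 2 - g8] already suffices; hence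
   [k] and [w] may be taken below 1. *)
have triv (s : R) : s <= 0 -> m / 2 - g8 + G * s <= X.
  by move=> s0; apply: le_trans X0; rewrite gerDl mulr_ge0_le0.
set k := 60 / (eps * m) * K; set w := 100 / m * bad.
have k0 : 0 <= k by rewrite mulr_ge0 // divr_ge0 // mulr_ge0 // ltW.
have w0 : 0 <= w by rewrite mulr_ge0 // divr_ge0 // ltW.
have [k1|k1] := leP 1 k; first by apply: triv; lra.
have [w1|w1] := leP 1 w; first by apply: triv; lra.
have Kb : K * (12 / eps) <= m / 5.
  have -> : K * (12 / eps) = k * (m / 5) by rewrite /k; field; rewrite !gt_eqF.
  by rewrite -[leRHS]mul1r ler_wpM2r ?divr_ge0 // ltW.
have bb : bad <= m / 100.
  have -> : bad = w * (m / 100) by rewrite /w; field; rewrite !gt_eqF.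
  by rewrite -[leRHS]mul1r ler_wpM2r ?divr_ge0 // ltW.
have GG : G * (1 - k - w) <= G by rewrite -[leRHS]mulr1 ler_wpM2l //; lra.
(* The first cut gives at least [(0.99 - 0.275 - 0.2) * m], above [m / 2 + m / 80]. In the next case
   the cross edges alone give [0.52 * m]. *)
have [c1|c1] := leP (9 / 20 * m) m11; first by lra.
have [c2|c2] := leP (13 / 25 * m) m12; first by lra.
(* Now [m22 >= 0.03 * m], which leaves [0.02 * m] good edges and makes [m22] at least [m / 36]. *)
have g2 : m / 50 <= good by lra.
have r3 : r / 6 <= r22.
  rewrite -ler_sqr ?nnegrE ?mulr_ge0 // exprMn r2 r222; lra.
have : d / 50 / 5 * (m / 50) <= d / 50 / 5 * good by rewrite ler_wpM2l // !divr_ge0 // ltW.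
have -> : d / 50 / 5 * (m / 50) = (d * m) / 50 / 50 / 5 by field.
have dm : 0 <= d * m by rewrite mulr_ge0 // ltW.
move: GG; rewrite GE; lra.
Qed.

(** The correction is linear in the number of non-isolated vertices put in [V1] and in the total
    high degree missed, so that averaging over [V1] needs only their expectations. *)
Lemma cond_mean_gain e (eps alpha : R) (V1 : {set 'I_n}) :
  let d := eps `^ (1 + alpha) in let m : R := #|edge_set e|%:R in
  symmetric e -> irreflexive e -> 0 < eps -> 0 < d <= 1 -> 1 <= m ->
  99 / 100 * m <= (OPT e)%:R ->
  m / 2 - 8 / eps + (Num.sqrt m / 30 / 30 + d * m / 60 / 60 / 80) *
    (1 - 60 / (eps * m) * #|[set v in V1 | (0 < deg e v)%N]|%:R
       - 100 / m * \sum_v (deg e v)%:R * ((v \notin V1) && (48 / d < (deg e v)%:R))%:R)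
  <= cond_mean e eps alpha V1.
Proof.
move=> d m es ei eps0 d01 m1 hopt; have /andP[d0 d1] := d01.
have q01 : 0 <= d / 70 <= 1 by apply/andP; split; lra.
have [S hS] : exists S, OPT e = val (edge_set e) S.
  rewrite /OPT; have [|S ->] := @bigop.eq_bigmax {ffun 'I_n -> bool} (fun S => val (edge_set e) S).
    by apply/card_gt0P; exists [ffun=> true].
  by exists S.
pose E := edge_set e; pose E11 := induced E V1; pose Et := induced E (~: V1).
have m0 : 0 <= m by lra.
apply: (@gain_cases m #|E11|%:R (val E [ffun v => v \in V1])%:R #|Et|%:R (Num.sqrt m)
  (Num.sqrt #|Et|%:R) d _ _ #|[set p in Et | low_deg e (48 / d) p]|%:R (val E11 S)%:R (8 / eps) eps _ _) => //; rewrite ?sqrtr_ge0 ?sqr_sqrtr //.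
- exact: card_split.
- by apply: sumr_ge0 => v _; rewrite mulr_ge0.
- by have := val_induced_ge E V1 S; rewrite -/E11 -hS -/m; lra.
- exact: (@card_low_degree e V1 (48 / d) es ei).
- apply: cond_mean_ge_cst => // E2 f _; apply: le_trans (@final_mean_ge_S1 R n e eps V1 eps0 E2 f).
  by rewrite lerB // gexp_S1_ge_half.
- apply: cond_mean_ge_cst => // E2 f _; apply: le_trans (@final_mean_ge_S1 R n e eps V1 eps0 E2 f).
  by rewrite lerB // gexp_S1_ge_cut.
- by apply: cond_mean_ge_cst => // E2 f _; exact: final_mean_ge_S3.
have := @cond_mean_ge_matching R n e eps alpha V1
   (low_deg e (48 / d)) es ei eps0 q01.
have := @sum_mutual_ge e V1 d es ei d0; have := sqrtr_ge0 (#|Et|%:R : R).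
by rewrite -/d -/m -/Et; lra.
Qed.

End Gain.

(** * Averaging over the noisy degrees *)

Section Step1.
Context {R : realType} {n : nat}.
Variables (e : rel 'I_n) (eps d eta : R).
Hypotheses (es : symmetric e) (ei : irreflexive e).
Hypotheses (eps0 : 0 < eps) (eta0 : 0 < eta) (dE : d = eps * eta).
Let m : R := #|edge_set e|%:R.
Let x (v : 'I_n) : R := lap_tail (12 / eps) (24 / d - (deg e v)%:R).
Let d0 : 0 < d. Proof. by rewrite dE mulr_gt0. Qed.
Let b0 : 0 < 12 / eps. Proof. by rewrite divr_gt0. Qed.

(** A bound proportional to the degree, so that the sum over vertices is of order [m * d]. From
    degree [2.4 / d] on it exceeds 1; below, the noise must exceed [21.6 / d], of probability at
    most [expR (- 1.8 / eta) <= d / 10]. *)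
Lemma tail_low v : expR (- ((18 / 10) / eta)) <= d / 10 -> (0 < deg e v)%N ->
  x v <= (deg e v)%:R * (d * (5 / 12)).
Proof.
move=> hd; rewrite -(ler1n R); set k : R := (deg e v)%:R => k1.
have [le|lt] := leP (24 / 10 / d) k.
  have /andP[_ x1] := lap_tail_bounds b0 (24 / d - k).
  apply: le_trans x1 _; move: le; rewrite ler_pdivrMr // => le.
  have -> : k * (d * (5 / 12)) = k * d * (5 / 12) by ring.
  lra.
have t0 : 21 / d + 6 / 10 / d <= 24 / d - k.
  have -> : 24 / d = 21 / d + 6 / 10 / d + 24 / 10 / d by field; rewrite gt_eqF.
  lra.
have dpos : 0 <= 21 / d + 6 / 10 / d by rewrite addr_ge0 // !divr_ge0 // ltW.
apply: le_trans (lap_tail_le b0 (le_trans dpos t0)) _.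
apply: (@le_trans _ _ (expR (- ((18 / 10) / eta)))).
  rewrite ler_expR mulNr lerN2 invf_div mulrA ler_pdivlMr //.
  have -> : 18 / 10 / eta * 12 = (21 / d + 6 / 10 / d) * eps.
    by rewrite dE; field; rewrite !gt_eqF.
  by rewrite ler_pM2r.
apply: le_trans hd _; have : d <= k * d by rewrite ler_peMl // ltW.
have : 0 < d := d0.
have -> : k * (d * (5 / 12)) = k * d * (5 / 12) by ring.
lra.
Qed.

(** The noise must fall below [- 24 / d], two units of [1 / eta] at scale [12 / eps]; the resulting
    [expR (- 2 / eta)] is at most [eta ^+ 2]. *)
Lemma head_high v : 48 / d < (deg e v)%:R -> 1 - x v <= eta ^+ 2.
Proof.
set k : R := (deg e v)%:R => hk.
have t0 : 24 / d - k <= - (24 / d).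
  have E : 48 / d = 24 / d + 24 / d by field; rewrite gt_eqF.
  by move: hk; rewrite E; lra.
have dpos : 0 < 24 / d by rewrite divr_gt0.
have tneg : 24 / d - k < 0 by lra.
apply: le_trans (lap_head_le b0 tneg) _.
have e1 : expR (- eta^-1) <= eta.
  rewrite expRN -[leRHS]invrK lef_pV2 ?posrE ?expR_gt0 ?invr_gt0 //.
  by have := expR_ge1Dx eta^-1; lra.
apply: (@le_trans _ _ (expR (- eta^-1) ^+ 2)); last by rewrite lerXn2r ?nnegrE ?expR_ge0 // ltW.
rewrite -expRM_natl ler_expR invf_div mulrA ler_pdivrMr //.
have -> : 2 * - eta^-1 * 12 = - (24 / d) * eps by rewrite dE; field; rewrite !gt_eqF.
by rewrite ler_pM2r.
Qed.

Lemma sum_deg_const (a : R) : \sum_v (deg e v)%:R * a = 2 * m * a.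
Proof.
rewrite (@sum_deg R n e (fun=> a)) // sumr_const -[_ *+ _]mulr_natl -/m; ring.
Qed.

Lemma expected_noisy : expR (- ((18 / 10) / eta)) <= d / 10 ->
  \sum_V1 bern x V1 * #|[set v in V1 | (0 < deg e v)%N]|%:R <= m * d * (5 / 6).
Proof.
move=> hd.
have -> : m * d * (5 / 6) = 2 * m * (d * (5 / 12)) by field.
rewrite -sum_deg_const.
have -> : \sum_V1 bern x V1 * #|[set v in V1 | (0 < deg e v)%N]|%:R =
    \sum_v (0 < deg e v)%N%:R * \sum_(V1 : {set 'I_n}) bern x V1 * (v \in V1)%:R.
  under [RHS]eq_bigr => v _ do rewrite mulr_sumr.
  rewrite exchange_big /=; apply: eq_bigr => V1 _; rewrite card_sum mulr_sumr.
  apply: eq_bigr => v _; rewrite inE mulrCA; congr (_ * _).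
  by case: (_ \in _); rewrite ?mulr1 ?mulr0.
apply: ler_sum => v _; rewrite bern_mem.
case: (posnP (deg e v)) => [->|dv]; first by rewrite !mul0r.
by rewrite mul1r; exact: tail_low.
Qed.

Lemma expected_missed :
  \sum_V1 bern x V1 * \sum_v (deg e v)%:R * ((v \notin V1) && (48 / d < (deg e v)%:R))%:R
    <= 2 * m * eta ^+ 2.
Proof.
rewrite -sum_deg_const.
have -> : \sum_V1 bern x V1 * \sum_v (deg e v)%:R * ((v \notin V1) && (48 / d < (deg e v)%:R))%:R =
    \sum_v (deg e v)%:R * (((48 / d < (deg e v)%:R :> R))%:R *
      \sum_(V1 : {set 'I_n}) bern x V1 * (v \notin V1)%:R).
  under [RHS]eq_bigr => v _ do rewrite !mulr_sumr.
  rewrite exchange_big /=; apply: eq_bigr => V1 _; rewrite mulr_sumr.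
  apply: eq_bigr => v _; rewrite mulrCA; congr (_ * _); rewrite mulrCA; congr (_ * _).
  by case: (_ \notin _); rewrite ?mulr1 ?mulr0.
apply: ler_sum => v _; rewrite ler_wpM2l // bern_notin.
case: (leP (deg e v)%:R (48 / d)) => hv; first by rewrite mul0r sqr_ge0.
by rewrite mul1r head_high.
Qed.

Lemma bern_x_ge0 V1 : 0 <= bern x V1.
Proof. by apply: bern_ge0 => v; apply: lap_tail_bounds. Qed.

End Step1.

Lemma alg_expect_ge (R : realType) n (e : rel 'I_n) (eps alpha : R) :
  let d := eps `^ (1 + alpha) in let m : R := #|edge_set e|%:R in
  symmetric e -> irreflexive e -> 0 < eps -> eps <= 1 ->
  eps `^ alpha <= 11 / 10 / 100 -> expR (- ((18 / 10) / eps `^ alpha)) <= d / 10 -> 1 <= m ->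
  m / 2 - 8 / eps <= alg_expect e eps alpha /\
  (99 / 100 * m <= (OPT e)%:R ->
   m / 2 - 8 / eps + (Num.sqrt m / 30 / 30 + d * m / 60 / 60 / 80) * (2 / 5)
     <= alg_expect e eps alpha).
Proof.
move=> d m es ei eps0 eps1; set eta := eps `^ alpha => heta hd m1.
have eta0 : 0 < eta by rewrite powR_gt0.
have dE : d = eps * eta.
  by rewrite /d powRD ?(gt_eqF eps0) ?implybT // powRr1 // ltW.
have d01 : 0 < d <= 1.
  rewrite dE mulr_gt0 //=; apply: mulr_ile1 => //; [exact: ltW | exact: ltW | lra].
have q01 : 0 <= d / 70 <= 1 by have /andP[? ?] := d01; apply/andP; split; lra.
have m0 : 0 < m by lra.
rewrite alg_expectE.
pose x (v : 'I_n) : R := lap_tail (12 / eps) (24 / d - (deg e v)%:R).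
have -> : forall F, \sum_V1 pV1 e eps alpha V1 * F V1 = \sum_V1 bern x V1 * F V1 by [].
have bx0 V1 : 0 <= bern x V1 by apply: bern_x_ge0.
split=> [|hopt].
  rewrite -[leLHS]mul1r -[X in X * _ <= _](bern_sum1 x) mulr_suml; apply: ler_sum => V1 _.
  apply: ler_wpM2l => //; apply: cond_mean_ge_cst => // E2 f _.
  apply: le_trans (@final_mean_ge_S1 R n e eps V1 eps0 E2 f).
  by rewrite lerB // gexp_S1_ge_half.
set G := Num.sqrt m / 30 / 30 + d * m / 60 / 60 / 80.
have G0 : 0 <= G.
  have /andP[? ?] := d01.
  by rewrite addr_ge0 // !divr_ge0 ?sqrtr_ge0 // mulr_ge0 // ltW.
pose K (V1 : {set 'I_n}) : R := #|[set v in V1 | (0 < deg e v)%N]|%:R.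
pose B (V1 : {set 'I_n}) : R :=
  \sum_v (deg e v)%:R * ((v \notin V1) && (48 / d < (deg e v)%:R))%:R.
apply: (@le_trans _ _ (\sum_V1 bern x V1 *
  (m / 2 - 8 / eps + G * (1 - 60 / (eps * m) * K V1 - 100 / m * B V1)))); last first.
  by apply: ler_sum => V1 _; apply: ler_wpM2l => //; exact: cond_mean_gain.
have -> : \sum_V1 bern x V1 * (m / 2 - 8 / eps + G * (1 - 60 / (eps * m) * K V1 - 100 / m * B V1))
   = m / 2 - 8 / eps + G * (1 - 60 / (eps * m) * (\sum_V1 bern x V1 * K V1)
       - 100 / m * (\sum_V1 bern x V1 * B V1)).
  set a := m / 2 - 8 / eps; set p := 60 / _; set q := 100 / m.
  transitivity (\sum_V1 bern x V1 * (a + G) - \sum_V1 G * p * (bern x V1 * K V1)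
     - \sum_V1 G * q * (bern x V1 * B V1)).
    by rewrite -!sumrB; apply: eq_bigr => V1 _; ring.
  rewrite -mulr_suml bern_sum1 -!mulr_sumr; ring.
rewrite lerD2l ler_wpM2l //.
have hK : \sum_V1 bern x V1 * K V1 <= m * d * (5 / 6) by exact: (@expected_noisy R n e eps d eta).
have hB : \sum_V1 bern x V1 * B V1 <= 2 * m * eta ^+ 2 by exact: expected_missed.
have : 60 / (eps * m) * (\sum_V1 bern x V1 * K V1) <= 50 * eta.
  have -> : 50 * eta = 60 / (eps * m) * (m * d * (5 / 6)).
    by rewrite dE; field; rewrite !gt_eqF.
  by apply: ler_wpM2l hK; rewrite divr_ge0 // mulr_ge0 // ltW.
have : 100 / m * (\sum_V1 bern x V1 * B V1) <= 200 * eta ^+ 2.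
  have -> : 200 * eta ^+ 2 = 100 / m * (2 * m * eta ^+ 2) by field; rewrite gt_eqF.
  by apply: ler_wpM2l hB; rewrite divr_ge0 // ltW.
(* With [eta <= 0.011] the corrections are at most [0.55] and [0.0242], leaving a factor above
   [2 / 5]. *)
have : eta ^+ 2 <= eta * (11 / 10 / 100) by rewrite expr2 ler_pM2l.
lra.
Qed.

(** * Absolute constants and comparison with the optimum *)

Theorem theorem5p8 (R : realType) :
  exists C c : R, 0 < C /\ 0 < c /\
  forall (alpha eps : R) (n : nat) (e : rel 'I_n),
    0 < alpha -> 0 <= eps -> eps <= 1 / 10 ->
    eps `^ alpha <= Num.min (106 / 10000) ((18 / 10) / ln (10 / eps `^ (1 + alpha))) ->
    symmetric e -> irreflexive e ->
    C <= (#|edge_set e|)%:R * eps ^+ 2 ->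
    (1 / 2 + c * eps `^ (1 + alpha)) * (OPT e)%:R <= alg_expect e eps alpha.
Proof.
exists ((20 * 30 * 30) ^+ 2), (60 * 60 * 200)^-1.
split; first by rewrite exprn_gt0 // !mulr_gt0.
split; first by rewrite invr_gt0 !mulr_gt0.
move=> alpha eps n e alpha0 eps_ge0 eps_le; rewrite le_min => /andP[eta1 eta2] es ei hC.
(* The value [eps = 0] is excluded by the positive lower bound on [m * eps ^+ 2]. *)
have eps0 : 0 < eps.
  rewrite lt_neqAle eps_ge0 andbT eq_sym; apply: contraTneq hC => ->.
  by rewrite expr0n mulr0 -ltNge exprn_gt0 // !mulr_gt0.
set d := eps `^ (1 + alpha); set m : R := #|edge_set e|%:R in hC *.
have d0 : 0 < d by rewrite powR_gt0.
have eta0 : 0 < eps `^ alpha by rewrite powR_gt0.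
have {eta1} heta : eps `^ alpha <= 11 / 10 / 100 by apply: le_trans eta1 _; lra.
have d1 : d <= 1.
  rewrite /d powRD ?(gt_eqF eps0) ?implybT // powRr1 //; apply: mulr_ile1 => //; first exact: ltW.
    by apply: le_trans eps_le _; lra.
  by apply: le_trans heta _; lra.
have L0 : 0 < ln (10 / d) by rewrite ln_gt0 // ltr_pdivlMr // mul1r; apply: le_lt_trans d1 _; rewrite ltr1n.
(* The logarithmic hypothesis is exactly this tail condition, once [ln (10 / d)] is known to be
   positive. *)
have {eta2} hd : expR (- ((18 / 10) / eps `^ alpha)) <= d / 10.
  have -> : d / 10 = expR (- ln (10 / d)).
    by rewrite expRN lnK ?posrE ?divr_gt0 // invf_div.
  rewrite ler_expR lerN2; move: eta2; rewrite -/d.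
  by rewrite ler_pdivlMr // mulrC -ler_pdivlMr.
set r := Num.sqrt m; have r0 : 0 <= r := sqrtr_ge0 m.
have r2 : r ^+ 2 = m by rewrite sqr_sqrtr.
have {hC} re : 20 * 30 * 30 <= r * eps.
  by rewrite -ler_sqr ?nnegrE ?mulr_ge0 // [leRHS]exprMn r2.
have eps1 : eps <= 1 by apply: le_trans eps_le _; lra.
have r1 : 20 * 30 * 30 <= r by apply: le_trans re _; rewrite ler_piMr.
have rm : r * (20 * 30 * 30) <= m by rewrite -r2 expr2 ler_wpM2l.
(* This fixes [C]: from [r * eps >= 18000], the loss [8 / eps] is at most [r / 2250], the gain due
   to the chaos. *)
have e8 : 8 / eps <= r / 30 / 30 * (2 / 5).
  rewrite ler_pdivrMr //.
  have -> : r / 30 / 30 * (2 / 5) * eps = r * eps * (8 / (20 * 30 * 30)) by field.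
  by rewrite mulrA ler_pdivlMr ?mulr_gt0 // [r * eps * 8]mulrC ler_pM2l.
have mr : r <= m by apply: le_trans rm; rewrite ler_peMr // -!natrM ler1n.
have m1 : 1 <= m by apply: le_trans mr; apply: le_trans r1; rewrite -!natrM ler1n.
have [low high] := @alg_expect_ge R n e eps alpha es ei eps0 eps1 heta hd m1.
have m0 : 0 <= m by lra.
have {re r1} opt_le : (OPT e)%:R <= m.
  by rewrite ler_nat; apply/bigmax_leqP => S _; exact: val_le.
have dm : d * m <= m by rewrite -[leRHS]mul1r ler_wpM2r.
set c := (60 * 60 * 200)^-1.
have c0 : 0 < c by rewrite invr_gt0 !mulr_gt0.
have [hopt|hopt] := leP (99 / 100 * m) (OPT e)%:R.
  apply: le_trans (high hopt); rewrite -/d -/m -/r.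
  apply: (@le_trans _ _ ((1 / 2 + c * d) * m)).
    by apply: ler_wpM2l opt_le; rewrite addr_ge0 // mulr_ge0 // ltW.
  have -> : (1 / 2 + c * d) * m = m / 2 + d * m / 60 / 60 / 80 * (2 / 5) by rewrite /c; field.
  lra.
(* The optimum is below [0.99 * m], so the target is at most [0.495 * m + m / 400]; the loss is at
   most another [m / 400], which stays within [m / 2]. *)
apply: le_trans low; rewrite -/m.
apply: (@le_trans _ _ ((1 / 2 + c * d) * (99 / 100 * m))).
  by apply: ler_wpM2l (ltW hopt); rewrite addr_ge0 // mulr_ge0 // ltW.
have -> : (1 / 2 + c * d) * (99 / 100 * m) = 99 / 200 * m + c * (99 / 100 * (d * m)) by field.
have : c * (99 / 100 * (d * m)) <= c * (60 * 60 * 200 * (m / 400)) by rewrite ler_pM2l //; lra.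
have -> : c * (60 * 60 * 200 * (m / 400)) = m / 400 by rewrite /c; field.
have : r / 30 / 30 * (2 / 5) <= m / 400 by lra.
lra.
Qed.
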